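(* Let $k$ be a field of characteristic different from $2$ and let $\mathcal{I}\subset\mathbb{P}^4$ be an Igusa quartic over $k$. Suppose $a,b\in\mathcal{I}\setminus\mathcal{E}$ are distinct points and that $\mathbf{P}(a,b)=\mathbf{P}(b,a)=0$. Then $T_a\mathcal{I}\cap T_b\mathcal{I}$ is a trope to both $\mathcal{K}_a$ and $\mathcal{K}_b$. The intersection $\mathcal{K}_a\cap\mathcal{K}_b$ is a double-counting conic through $a$, $b$, and five common singularities of $\mathcal{K}_a,\mathcal{K}_b$.
   Context: Igusa quartics. Let $\mathcal{I}_4$ be the quartic threefold given in $\mathbb{P}^5$ by $\sum_{j=0}^5x_j=0$, $\bigl(\sum_{j=0}^5x_j^2\bigr)^2-4\sum_{j=0}^5x_j^4=0$, regarded as a hypersurface in the hyperplane $\sum_j x_j=0$, which is a $\mathbb{P}^4$. An Igusa quartic over $k$ is a quartic threefold $\mathcal{I}\subset\mathbb{P}^4$ over $k$ that is isomorphic to $\mathcal{I}_4$ over a separable closure of $k$. Its singular locus consists geometrically of $15$ lines. Let $\mathcal{E}\subset\mathcal{I}$ be the locus where the tangent space fails to cut out a normal quartic surface; on $\mathcal{I}_4$ it is the union of the $S_6$-orbit of the hyperplane section $x_0+x_1+x_2=0$. For $a\in\mathcal{I}\setminus\mathcal{E}$ let $T_a\mathcal{I}\subset\mathbb{P}^4$ be the projective tangent hyperplane and $\mathcal{K}_a=T_a\mathcal{I}\cap\mathcal{I}$; it is a Kummer quartic surface in $T_a\mathcal{I}\simeq\mathbb{P}^3$, i.e. a quartic surface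 with $16$ nodes: $a$ and the $15$ intersections with the singular lines of $\mathcal{I}$. A trope of a Kummer quartic surface is a plane meeting it in a conic counted with multiplicity $2$ (a ''double-counting conic''). With $F$ the quartic form defining $\mathcal{I}$, $\mathbf{P}(a,b)=\sum_i\partial_iF|_a\,b_i$, so that $\mathbf{P}(a,b)=0$ if and only if $b\in T_a\mathcal{I}$. *)

(* Defs.v *)
From HB Require Import structures.
From mathcomp Require Import all_boot all_order all_algebra all_field.
From mathcomp Require Import mpoly.

Set Implicit Arguments.
Unset Strict Implicit.
Unset Printing Implicit Defensive.

Import GRing.Theory.
Local Open Scope ring_scope.

(* A point of P^n is given by a nonzero row vector of homogeneous coordinates,
   two of them giving the same point when their row spaces agree ([==%MS]);
   a linear subspace of P^n is given by the row space of a matrix. *)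

Definition separable_closure (k K : fieldType) (iota : {rmorphism k -> K}) :
    Prop :=
  (forall x : K,
     exists2 p : {poly k}, separable_poly p & root (map_poly iota p) x) /\
  (forall p : {poly K}, separable_poly p -> (1 < size p)%N ->
     exists x, root p x).

(* The restriction of the form F to the linear subspace spanned by the rows of
   B, as a form in the coordinates [y] of the point [y *m B]. *)
Definition section (R : comNzRingType) (m n : nat) (F : {mpoly R[n]})
    (B : 'M[R]_(m, n)) : {mpoly R[m]} :=
  F \mPo [tuple \sum_(j < m) B j i *: 'X_j | i < n].

Definition igusa_form (R : comNzRingType) : {mpoly R[6]} :=
  (\sum_(j < 6) 'X_j ^+ 2) ^+ 2 - 4%:R *: (\sum_(j < 6) 'X_j ^+ 4).

(* The rows of M are coordinates on the hyperplane \sum_j x_j = 0 of P^5, so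
   [section (igusa_form K) M] is an equation of I_4 in that P^4. *)
Definition igusa_quartic (k K : fieldType) (iota : {rmorphism k -> K})
    (F : {mpoly k[5]}) : Prop :=
  F \is 4.-homog /\
  exists (M : 'M[K]_(5, 6)) (c : K),
    [/\ row_free M,
        (forall i, \sum_(j < 6) M i j = 0),
        c != 0 &
        map_mpoly iota F = c *: section (igusa_form K) M].

Section Field.
Variable K : fieldType.

Definition polar (n : nat) (F : {mpoly K[n]}) (a b : 'rV[K]_n) : K :=
  \sum_(i < n) (F^`M(i)).@[a 0] * b 0 i.

(* The whole space when a is a singular point of F. *)
Definition tangent (n : nat) (F : {mpoly K[n]}) (a : 'rV[K]_n) : 'M[K]_n :=
  kermx (\col_(i < n) (F^`M(i)).@[a 0]).

Definition singular_point (n : nat) (f : {mpoly K[n]}) (y : 'rV[K]_n) : Prop :=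
  [/\ y != 0, f.@[y 0] = 0 & forall i, (f^`M(i)).@[y 0] = 0].

(* R / J is an integrally closed domain; phi identifies it with a subring
   of L. *)
Definition normal_quotient (R : comNzRingType) (J : R -> Prop) : Prop :=
  exists (L : fieldType) (phi : {rmorphism R -> L}),
    (forall p, phi p = 0 <-> J p) /\
    (forall z, (exists p q, phi q != 0 /\ z = phi p / phi q) ->
       integralOver phi z -> exists r, z = phi r).

(* The ideal of the affine chart x_i = 1 of the hypersurface f = 0. *)
Definition chart_ideal (n : nat) (f : {mpoly K[n]}) (i : 'I_n)
    (p : {mpoly K[n]}) : Prop :=
  exists u v, p = u * f + v * ('X_i - 1).

(* A surface in P^3 is connected, hence integral as soon as it is normal: the
   coordinate rings of its nonempty affine charts are then domains. *)
Definition normal_surface (f : {mpoly K[4]}) : Prop :=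
  f != 0 /\
  forall i, chart_ideal f i 1 \/ normal_quotient (chart_ideal f i).

(* The locus E. It contains the singular points of F, where the tangent space
   is not a hyperplane. *)
Definition in_E (F : {mpoly K[5]}) (a : 'rV[K]_5) : Prop :=
  F.@[a 0] = 0 /\
  ~ exists B : 'M[K]_(4, 5),
      [/\ row_free B, (B == tangent F a)%MS & normal_surface (section F B)].

(* x is a singular point of the surface cut out by F on the hyperplane T. *)
Definition singular_on (F : {mpoly K[5]}) (T : 'M[K]_5) (x : 'rV[K]_5) : Prop :=
  exists (B : 'M[K]_(4, 5)) (y : 'rV[K]_4),
    [/\ row_free B, (B == T)%MS, x = y *m B & singular_point (section F B) y].

(* In characteristic different from 2, the singular locus of a conic is the
   kernel of its Gram matrix, so testing K-rational points is enough. *)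
Definition smooth_conic (q : {mpoly K[3]}) : Prop :=
  q \is 2.-homog /\ forall y, ~ singular_point q y.

(* The plane P, with basis B, meets F = 0 exactly in the conic q = 0 counted
   twice, q being written in the coordinates on P defined by B. *)
Definition cuts_double_conic (F : {mpoly K[5]}) (P : 'M[K]_5)
    (B : 'M[K]_(3, 5)) (q : {mpoly K[3]}) : Prop :=
  [/\ row_free B, (B == P)%MS, smooth_conic q &
      exists2 c, c != 0 & section F B = c *: q ^+ 2].

(* P is a trope of the surface cut out by F on T. *)
Definition trope (F : {mpoly K[5]}) (T P : 'M[K]_5) : Prop :=
  [/\ (P <= T)%MS, \rank P = 3%N & exists B q, cuts_double_conic F P B q].

Definition on_conic (B : 'M[K]_(3, 5)) (q : {mpoly K[3]}) (x : 'rV[K]_5) :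
    Prop :=
  exists2 y : 'rV[K]_3, x = y *m B & q.@[y 0] = 0.

End Field.

(* Main.v *)
Require Import Defs.
From HB Require Import structures.
From mathcomp Require Import all_boot all_order all_algebra all_field.
From mathcomp Require Import mpoly.
From mathcomp Require Import fingroup perm ring.
From Stdlib Require Import Classical.

Set Implicit Arguments.
Unset Strict Implicit.
Unset Printing Implicit Defensive.

Import GRing.Theory.
Local Open Scope ring_scope.

(* Let xi(x) be the gradient of the quartic at a point x of I_4, normalized to
   have coordinate sum zero. On the quartic, xi_i ^ 2 is an affine function of
   x_i; hence, in characteristic other than 2 and 3, the dual variety of I_4 is
   the Segre cubic \sum xi_i = \sum xi_i ^ 3 = 0, and P(a, b) = P(b, a) = 0 says
   that the line joining xi(a) and xi(b) lies on it. With coordinate sum zero the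
   Segre cubic reads a1 a2 a3 = b1 b2 b3 for six linear forms of the shape
   +- (xi_i + xi_j); on a line contained in it, unique factorization makes the
   a_i proportional to the b_j, up to a permutation. This yields an explicit
   two-parameter family of lines, whose dual conics span the planes
   T_a I :&: T_b I. On such a plane the quartic is visibly a square, and the
   five zeros of the binary form relating xi to the line are the nodes.

   The hypothesis that a and b avoid E enters through two facts: the sums
   x_i + x_j + x_k do not vanish, for otherwise the tangent section is a double
   quadric; and the characteristic is not 3, for otherwise I_4 is a cone and its
   tangent sections are singular along a line. *)

(** The permutation of the coordinates, the parameters and the nodes are found over [K], while the
    trope and its conic are wanted over [k]. The plane raises no problem, being an intersection of
    tangent spaces over [k]. The conic is brought down by taking a basis of the plane that begins
    with [a] and [b]: in it the coefficient of [X_0 X_1] can be normalized to 1, and the others are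
    then read off from derivatives of the restricted quartic at points over [k]. The two parameters
    [p], [q] are two of the three constant ratios of the a_i to the b_j; the third is 1 / (p q),
    because the product of the ratios is 1. The values 0 and 1 of [p], [q] and [p q = 1] are
    excluded because no xi_i + xi_j vanishes, and this holds because (xi_i + xi_j) ^ 2 is a constant
    times a product of sums x_i + x_l + x_m. The two exceptional cases contradict normality
    differently. A double quadric is not reduced, so its charts are not domains. A section singular
    along a line violates integral closedness, by an explicit integral fraction. Denominators are
    cleared throughout, which is the origin of constants such as 18 and 162. *)

Local Notation "''o_' i" := (@Ordinal 6 i isT)
  (at level 8, i at level 2, format "''o_' i").

(** * Forms and their restrictions to linear subspaces *)

Lemma mpoly_ring_ind (R : comNzRingType) n (P : {mpoly R[n]} -> Prop) :
  (forall c, P c%:MP) -> (forall i, P 'X_i) ->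
  (forall f g, P f -> P g -> P (f + g)) ->
  (forall f g, P f -> P g -> P (f * g)) ->
  forall f, P f.
Proof.
move=> PC PX PD PM; elim/mpolyind => [|c m f _ _ Pf]; first by rewrite -mpolyC0.
apply: PD Pf; rewrite -mul_mpolyC; apply: (PM) => //; rewrite mpolyXE_id.
apply: (big_ind P) => [||i _]; [by rewrite -mpolyC1|exact: PM|].
by elim: (m i) => [|k IHk]; rewrite ?expr0 -?mpolyC1 // exprS; apply: PM.
Qed.

Section SectionForms.
Variable R : comNzRingType.

Lemma mderivXU n (i j : 'I_n) :
  ('X_j : {mpoly R[n]})^`M(i) = (i == j)%:R.
Proof.
rewrite mderivX mnmE eq_sym; case: eqP => [->|]; last by rewrite scale0r.
by rewrite -{1}[U_(j)%MM]add0m addmK mpolyX0 scale1r.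
Qed.

Lemma section_meval m n (F : {mpoly R[n]}) (B : 'M[R]_(m, n)) (y : 'rV_m) :
  (section F B).@[y 0] = F.@[(y *m B) 0].
Proof.
rewrite /section comp_mpoly_meval; apply: meval_eq => i.
rewrite tnth_mktuple raddf_sum mxE /=; apply: eq_bigr => j _.
by rewrite mevalZ mevalXU mulrC.
Qed.

Lemma sectionX m n (B : 'M[R]_(m, n)) i :
  section 'X_i B = \sum_(j < m) B j i *: 'X_j.
Proof. by rewrite /section comp_mpolyXU -tnth_nth tnth_mktuple. Qed.

Lemma sectionC m n (B : 'M[R]_(m, n)) c : section c%:MP B = c%:MP.
Proof. exact: comp_mpolyC. Qed.

Lemma sectionM m n (F G : {mpoly R[n]}) (B : 'M[R]_(m, n)) :
  section (F * G) B = section F B * section G B.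
Proof. by rewrite /section rmorphM. Qed.

Lemma sectionD m n (F G : {mpoly R[n]}) (B : 'M[R]_(m, n)) :
  section (F + G) B = section F B + section G B.
Proof. by rewrite /section rmorphD. Qed.

Lemma sectionZ m n c (F : {mpoly R[n]}) (B : 'M[R]_(m, n)) :
  section (c *: F) B = c *: section F B.
Proof. exact: comp_mpolyZ. Qed.

Lemma mderiv_section m n (F : {mpoly R[n]}) (B : 'M[R]_(m, n)) j :
  (section F B)^`M(j) = \sum_i B j i *: section F^`M(i) B.
Proof.
elim/mpoly_ring_ind: F => [c|i|f g IHf IHg|f g IHf IHg].
- rewrite sectionC mderivC big1 // => i _.
  by rewrite mderivC -mpolyC0 sectionC mpolyC0 scaler0.
- rewrite sectionX raddf_sum (bigD1 j) //= [X in _ + X]big1 => [|l ljF].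
    rewrite (bigD1 i) //= [X in _ = _ + X]big1 => [|l liF].
      by rewrite mderivZ !mderivXU !eqxx -mpolyC1 sectionC.
    by rewrite mderivXU (negPf liF) -mpolyC0 sectionC mpolyC0 scaler0.
  by rewrite mderivZ mderivXU eq_sym (negPf ljF) scaler0.
- rewrite sectionD mderivD IHf IHg -big_split /=; apply: eq_bigr => i _.
  by rewrite mderivD sectionD scalerDr.
- rewrite sectionM mderivM IHf IHg mulr_suml mulr_sumr -big_split /=.
  apply: eq_bigr => i _; rewrite mderivM sectionD !sectionM scalerDr.
  by rewrite -scalerAl -scalerAr.
Qed.

Lemma section_section l m n (F : {mpoly R[n]}) (B : 'M[R]_(m, n))
    (C : 'M[R]_(l, m)) : section (section F B) C = section F (C *m B).
Proof.
elim/mpoly_ring_ind: F => [c|i|f g IHf IHg|f g IHf IHg].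
- by rewrite !sectionC.
- rewrite !sectionX /section raddf_sum /=.
  under eq_bigr => j _ do rewrite comp_mpolyZ -/(section _ C) sectionX scaler_sumr.
  rewrite exchange_big /=; apply: eq_bigr => j _; rewrite mxE scaler_suml.
  by apply: eq_bigr => t _; rewrite scalerA mulrC.
- by rewrite !sectionD IHf IHg.
- by rewrite !sectionM IHf IHg.
Qed.

Lemma section1 n (F : {mpoly R[n]}) : section F 1%:M = F.
Proof.
elim/mpoly_ring_ind: F => [c|i|f g IHf IHg|f g IHf IHg].
- by rewrite sectionC.
- rewrite sectionX (bigD1 i) //= mxE eqxx scale1r big1 ?addr0 // => j ji.
  by rewrite mxE (negPf ji) scale0r.
- by rewrite sectionD IHf IHg.
- by rewrite sectionM IHf IHg.
Qed.

Lemma section_igusa m (B : 'M[R]_(m, 6)) :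
  section (igusa_form R) B =
  (\sum_(i < 6) (\sum_(j < m) B j i *: 'X_j) ^+ 2) ^+ 2
  - 4%:R *: (\sum_(i < 6) (\sum_(j < m) B j i *: 'X_j) ^+ 4).
Proof.
have pow k : section (\sum_(i < 6) 'X_i ^+ k) B =
    \sum_(i < 6) (\sum_(j < m) B j i *: 'X_j) ^+ k.
  rewrite /section rmorph_sum; apply: eq_bigr => i _.
  by rewrite rmorphXn /= -/(section _ _) sectionX.
by rewrite /igusa_form /section rmorphB rmorphXn /= comp_mpolyZ -!/(section _ _) !pow.
Qed.

End SectionForms.

(** * Extension of the base field *)

Section Map.
Variables (k K : fieldType) (iota : {rmorphism k -> K}).

Lemma map_section m n (F : {mpoly k[n]}) (B : 'M[k]_(m, n)) :
  map_mpoly iota (section F B) = section (map_mpoly iota F) (map_mx iota B).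
Proof.
elim/mpoly_ring_ind: F => [c|i|f g IHf IHg|f g IHf IHg].
- by rewrite sectionC !map_mpolyC sectionC.
- rewrite sectionX map_mpolyX sectionX raddf_sum /=; apply: eq_bigr => j _.
  by rewrite map_mpolyZ map_mpolyX mxE.
- by rewrite sectionD !rmorphD /= sectionD IHf IHg.
- by rewrite sectionM !rmorphM /= sectionM IHf IHg.
Qed.

Lemma map_mderiv n (F : {mpoly k[n]}) i :
  map_mpoly iota F^`M(i) = (map_mpoly iota F)^`M(i).
Proof.
elim/mpoly_ring_ind: F => [c|j|f g IHf IHg|f g IHf IHg].
- by rewrite mderivC raddf0 map_mpolyC mderivC.
- by rewrite map_mpolyX !mderivX map_mpolyZ map_mpolyX rmorph_nat.
- by rewrite mderivD !rmorphD /= mderivD IHf IHg.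
- by rewrite mderivM rmorphD !rmorphM /= mderivM IHf IHg.
Qed.

Lemma map_meval n (F : {mpoly k[n]}) (v : 'rV[k]_n) :
  (map_mpoly iota F).@[(map_mx iota v) 0] = iota F.@[v 0].
Proof.
elim/mpoly_ring_ind: F => [c|j|f g IHf IHg|f g IHf IHg].
- by rewrite map_mpolyC !mevalC.
- by rewrite map_mpolyX !mevalXU mxE.
- by rewrite !rmorphD /= IHf IHg.
- by rewrite !rmorphM /= IHf IHg.
Qed.

Lemma map_mpoly_inj n : injective (@map_mpoly n k K iota).
Proof.
move=> f g eqfg; apply/mpolyP => m; apply: (fmorph_inj iota).
by rewrite -!mcoeff_map_mpoly eqfg.
Qed.

Lemma map_polar n (F : {mpoly k[n]}) (a b : 'rV[k]_n) :
  polar (map_mpoly iota F) (map_mx iota a) (map_mx iota b) =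
  iota (polar F a b).
Proof.
rewrite /polar rmorph_sum; apply: eq_bigr => i _.
by rewrite rmorphM -map_mderiv map_meval mxE.
Qed.

Lemma map_tangent n (F : {mpoly k[n]}) (a : 'rV[k]_n) :
  tangent (map_mpoly iota F) (map_mx iota a) = map_mx iota (tangent F a).
Proof.
rewrite /tangent map_kermx; congr kermx; apply/matrixP => i j.
by rewrite !mxE -map_mderiv map_meval.
Qed.

End Map.

(** * Polar form and tangent spaces *)

Section Polar.
Variable K : fieldType.

Lemma sub_tangent m n (F : {mpoly K[n]}) (a : 'rV[K]_n) (B : 'M[K]_(m, n)) :
  reflect (forall i, polar F a (row i B) = 0) (B <= tangent F a)%MS.
Proof.
rewrite /tangent; apply: (iffP sub_kermxP) => [B0 i|B0].
  have /matrixP/(_ i 0) := B0; rewrite !mxE => <-.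
  by apply: eq_bigr => j _; rewrite !mxE mulrC.
apply/matrixP => i j; rewrite !mxE -[RHS](B0 i).
by apply: eq_bigr => l _; rewrite !mxE mulrC.
Qed.

Lemma polar_section m n (F : {mpoly K[n]}) (B : 'M[K]_(m, n)) (x y : 'rV_m) :
  polar (section F B) x y = polar F (x *m B) (y *m B).
Proof.
rewrite /polar.
under eq_bigr => i _ do rewrite mderiv_section raddf_sum mulr_suml.
rewrite exchange_big /=; apply: eq_bigr => i _; rewrite mxE mulr_sumr.
apply: eq_bigr => j _; rewrite mevalZ section_meval; ring.
Qed.

End Polar.

(** * Polynomials over a separably closed field *)

Lemma muniX (R : comNzRingType) n (i : 'I_n.+1) :
  muni ('X_i : {mpoly R[n.+1]}) =
  if split (cast_ord (esym (addn1 n)) i) is inl j then ('X_j)%:P else 'X.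
Proof. by rewrite /muni mmapX mmap1U. Qed.

Lemma muni_eq0 (R : comNzRingType) n (p : {mpoly R[n.+1]}) :
  (muni p == 0) = (p == 0).
Proof.
apply/eqP/eqP => [p0|->]; last exact: muni0.
(* [T] is a left inverse of [muni]: widen the coefficients, then substitute the last variable for
   the indeterminate. *)
pose T (q : {poly {mpoly R[n]}}) := (map_poly (@mwiden n R) q).['X_ord_max].
have TD q r : T (q + r) = T q + T r by rewrite /T rmorphD hornerD.
have TM q r : T (q * r) = T q * T r by rewrite /T rmorphM hornerM.
suff -> : p = T (muni p) by rewrite p0 /T rmorph0 horner0.
elim/mpoly_ring_ind: p {p0} => [c|i|f g IHf IHg|f g IHf IHg].
- by rewrite /T muniC map_polyC hornerC /= mwidenC.
- rewrite /T muniX; case: splitP => j /= ij.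
    rewrite map_polyC hornerC /= mwidenX mnmwiden1; congr 'X_[U_(_)].
    exact: val_inj.
  rewrite map_polyX hornerX; congr 'X_[U_(_)]; apply: val_inj => /=.
  by rewrite ij [j]ord1 addn0.
- by rewrite (muniD f g) TD {1}IHf {1}IHg.
- by rewrite (muniM f g) TM {1}IHf {1}IHg.
Qed.

(** The hypothesis expresses that [K] is infinite. The first variables are specialized at a point
    where the leading coefficient in the last one survives. *)
Lemma mpoly_eval_neq0 (K : fieldType) :
  (forall p : {poly K}, p != 0 -> exists x, p.[x] != 0) ->
  forall n (f : {mpoly K[n]}), f != 0 -> exists v : 'rV_n, f.@[v 0] != 0.
Proof.
move=> K_inf; elim=> [f|n IHn f].
  by rewrite [f]nvar0_mpolyC mpolyC_eq0 => c_neq0; exists 0; rewrite mevalC.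
rewrite -muni_eq0 -lead_coef_eq0 => /IHn[v fv_neq0].
have [|t ft] := K_inf (map_poly (meval (v 0)) (muni f)).
  apply: contra_neq fv_neq0 => /(congr1 (fun q : {poly K} => q`_(size (muni f)).-1)).
  by rewrite coef_map coef0.
exists (\row_i if split (cast_ord (esym (addn1 n)) i) is inl j then v 0 j else t).
set w := \row_i _.
suff -> : f.@[w 0] = (map_poly (meval (v 0)) (muni f)).[t] by [].
elim/mpoly_ring_ind: f {fv_neq0 ft} => [c|i|f g IHf IHg|f g IHf IHg].
- by rewrite mevalC muniC map_polyC hornerC /= mevalC.
- rewrite mevalXU muniX mxE; case: splitP => j _.
    by rewrite map_polyC hornerC /= mevalXU.
  by rewrite map_polyX hornerX.
- by rewrite mevalD IHf IHg muniD rmorphD hornerD.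
- by rewrite mevalM IHf IHg muniM rmorphM hornerM.
Qed.

Lemma separably_closed_sqrt (K : fieldType) : 2%:R != 0 :> K ->
  (forall p : {poly K}, separable_poly p -> (1 < size p)%N -> exists x, root p x) ->
  forall c : K, exists x, x ^+ 2 = c.
Proof.
move=> two_neq0 K_closed c; have [->|c_neq0] := eqVneq c 0.
  by exists 0; rewrite expr0n.
have [||x] := K_closed ('X^2 - c%:P); last first.
- by rewrite rootE !hornerE subr_eq0 => /eqP <-; exists x; rewrite expr2.
- by rewrite size_XnsubC.
rewrite unlock derivB derivXn derivC subr0 /= -scaler_nat.
rewrite coprimepZr // coprimepX rootE !hornerE expr0n sub0r oppr_eq0 //.
Qed.

(* A 2 ^ n-th root of -1 is a primitive root of unity of order 2 ^ n.+1. *)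
Lemma sqrt_closed_infinite (K : fieldType) : 2%:R != 0 :> K ->
  (forall c : K, exists x, x ^+ 2 = c) ->
  forall p : {poly K}, p != 0 -> exists x, p.[x] != 0.
Proof.
move=> two_neq0 K_sqrt p p_neq0.
have [z zE] : exists z : K, z ^+ (2 ^ size p) = -1.
  elim: (size p) => [|n [z zE]]; first by exists (-1).
  by have [w wz] := K_sqrt z; exists w; rewrite expnS exprM wz.
have [||m m_prim] := @prim_order_exists K (2 ^ (size p).+1) z.
- by rewrite expn_gt0.
- by rewrite expnSr exprM zE expr2 mulrNN mulr1.
move=> /(dvdn_pfactor _ _ (isT : prime 2))[d d_le mE].
have {}mE : m = (2 ^ (size p).+1)%N.
  move: d_le; rewrite mE leq_eqVlt ltnS => /orP[/eqP->//|d_le].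
  have : z ^+ (2 ^ size p) = 1.
    by apply/eqP; rewrite -(prim_order_dvd m_prim) mE dvdn_exp2l.
  by rewrite zE => /eqP; rewrite eq_sym -addr_eq0 (negPf two_neq0).
pose s := [seq z ^+ i | i <- iota 0 m].
have [/hasP[x _ px]|/hasPn s_root] := boolP (has (fun x => p.[x] != 0) s).
  by exists x.
have : (size s < size p)%N.
  apply: max_poly_roots => //.
    by apply/allP => x /s_root; rewrite negbK => /eqP/eqP.
  rewrite map_inj_in_uniq ?iota_uniq // => i j; rewrite !mem_iota /= => im jm.
  by move=> /eqP; rewrite (eq_prim_root_expr m_prim) !modn_small // => /eqP.
rewrite size_map size_iota mE ltnNge ltnW // (leq_trans (ltnSn _)) // ltnW //.
exact: ltn_expl.
Qed.

(** * Surfaces that are not normal *)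

Section Normality.
Variable K : fieldType.

Definition on_line n (y z : 'rV[K]_n) (f : {mpoly K[n]}) : {poly K} :=
  (map_mpoly polyC f).@[fun i => (y 0 i)%:P + z 0 i *: 'X].

Section OnLine.
Variables (n : nat) (y z : 'rV[K]_n).
Notation line := (on_line y z).

Lemma on_lineD f g : line (f + g) = line f + line g.
Proof. by rewrite /on_line rmorphD mevalD. Qed.

Lemma on_lineM f g : line (f * g) = line f * line g.
Proof. by rewrite /on_line rmorphM mevalM. Qed.

Lemma on_lineC c : line c%:MP = c%:P.
Proof. by rewrite /on_line map_mpolyC mevalC. Qed.

Lemma on_lineX i : line 'X_i = (y 0 i)%:P + z 0 i *: 'X.
Proof. by rewrite /on_line map_mpolyX mevalXU. Qed.

Lemma on_line_horner f t : (line f).[t] = f.@[(y + t *: z) 0].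
Proof.
elim/mpoly_ring_ind: f => [c|i|f g IHf IHg|f g IHf IHg].
- by rewrite on_lineC hornerC mevalC.
- by rewrite on_lineX mevalXU !mxE !hornerE mulrC.
- by rewrite on_lineD hornerD IHf IHg mevalD.
- by rewrite on_lineM hornerM IHf IHg mevalM.
Qed.

(** The line stays in the chart [x_i = 1], so that membership in the chart ideal becomes
    divisibility by the restriction of [f]. This is how non-membership is detected below. *)
Lemma on_line_chart f i u v : y 0 i = 1 -> z 0 i = 0 ->
  line (u * f + v * ('X_i - 1)) = line u * line f.
Proof.
move=> yi zi; rewrite on_lineD !on_lineM -mulN1r -mpolyC1 -mpolyCN -mpolyCM.
by rewrite on_lineD on_lineX on_lineC yi zi scale0r addr0 -rmorphD mulr1 subrr
  mulr0 addr0.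
Qed.

Lemma on_line_section m (E : 'M_(n, m)) l :
  line (section 'X_l E) = ((y *m E) 0 l)%:P + (z *m E) 0 l *: 'X.
Proof.
have line0 : line 0 = 0 by rewrite -mpolyC0 on_lineC.
rewrite sectionX (big_morph _ on_lineD line0) !mxE rmorph_sum scaler_suml -big_split.
apply: eq_bigr => j _; rewrite -mul_mpolyC on_lineM on_lineC on_lineX -!mul_polyC /=.
by rewrite !polyCM; ring.
Qed.

End OnLine.

Lemma meval_homog n d (f : {mpoly K[n]}) (t : K) (v : 'rV[K]_n) :
  f \is d.-homog -> f.@[(t *: v) 0] = t ^+ d * f.@[v 0].
Proof.
move=> /dhomogP f_homog; rewrite !mevalE mulr_sumr; apply: eq_big_seq => m mf.
rewrite mulrCA; congr (_ * _); have /= <- := f_homog _ mf.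
under eq_bigr => i _ do rewrite mxE exprMn.
by rewrite big_split /= prodrXr -mdegE.
Qed.

Lemma normal_chart_vanishing (f : {mpoly K[4]}) (y : 'rV[K]_4) i :
  normal_surface f -> f.@[y 0] = 0 -> y 0 i = 1 ->
  normal_quotient (chart_ideal f i).
Proof.
move=> [_ /(_ i)[]// [u [v E]]] fy yi.
have /(congr1 (meval (y 0))) := E.
rewrite meval1 mevalD !mevalM mevalB meval1 mevalXU fy yi subrr !mulr0 addr0.
by move=> /eqP; rewrite oner_eq0.
Qed.

(** [Q] is nilpotent modulo [f], so in a domain it would lie in the chart ideal. On a line of the
    chart from a zero of [Q] to a point where [Q] does not vanish, the restriction of [Q] would be
    divisible by its own square, which fails at the zero. *)
Lemma double_section_not_normal (f Q : {mpoly K[4]}) d c (y : 'rV[K]_4) :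
  (forall p : {poly K}, p != 0 -> exists x, p.[x] != 0) ->
  f = c *: Q ^+ 2 -> Q \is d.-homog -> y != 0 -> Q.@[y 0] = 0 ->
  ~ normal_surface f.
Proof.
move=> K_inf fE Q_homog y_neq0 Qy f_normal; have [f_neq0 _] := f_normal.
have c_neq0 : c != 0 by apply: contraNneq f_neq0 => c0; rewrite fE c0 scale0r.
have Q_neq0 : Q != 0.
  by apply: contraNneq f_neq0 => Q0; rewrite fE Q0 expr0n scaler0.
have [i yi] : exists i, y 0 i != 0.
  apply/existsP; apply: contraNT y_neq0; rewrite negb_exists => /forallP y0.
  by apply/eqP/rowP => i; rewrite mxE; apply/eqP; have := y0 i; rewrite negbK.
wlog {yi} yi : y y_neq0 Qy / y 0 i = 1 => [IH|].
  apply: (IH ((y 0 i)^-1 *: y)); last by rewrite mxE mulVf.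
    by rewrite scaler_eq0 invr_eq0 negb_or yi.
  by rewrite (meval_homog _ _ Q_homog) Qy mulr0.
have fy : f.@[y 0] = 0 by rewrite fE mevalZ mevalM Qy !mulr0.
have [L [phi [phi0 _]]] := normal_chart_vanishing f_normal fy yi.
have phif : phi f = 0 by apply/phi0; exists 1, 0; rewrite mul1r mul0r addr0.
have phic : phi c%:MP != 0.
  apply/eqP => /phi0[u [v /(congr1 (meval (y 0)))]].
  rewrite mevalC mevalD !mevalM mevalB meval1 mevalXU fy yi subrr !mulr0 addr0.
  by move/eqP; rewrite (negPf c_neq0).
have /phi0[u [v QE]] : phi Q = 0.
  apply/eqP; rewrite -sqrf_eq0 -rmorphXn -(mulrI_eq0 _ (mulfI phic)) -rmorphM /=.
  by rewrite mul_mpolyC -fE phif.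
have [|w] := mpoly_eval_neq0 K_inf (f := Q * 'X_i).
  rewrite mulf_neq0 //; apply/eqP => /(congr1 (meval (y 0))).
  by rewrite mevalXU meval0 yi => /eqP; rewrite oner_eq0.
rewrite mevalM mevalXU mulf_eq0 negb_or => /andP[Qw wi].
pose z := (w 0 i)^-1 *: w - y.
have zi : z 0 i = 0 by rewrite !mxE mulVf // yi subrr.
have := congr1 (on_line y z) QE; rewrite on_line_chart // fE -mul_mpolyC.
rewrite !on_lineM on_lineC.
move qdef: (on_line y z Q) (on_line y z u) => q u' qE.
have /eqP : q * (1 - u' * (c%:P * q)) = 0.
  by rewrite mulrBr mulr1; apply/eqP; rewrite subr_eq0; apply/eqP;
    rewrite [LHS]qE; ring.
rewrite mulf_eq0 => /orP[] /eqP.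
  move: qdef => <- /(congr1 (fun p => p.[1])); rewrite horner0 on_line_horner scale1r.
  rewrite addrC subrK (meval_homog _ _ Q_homog) => /eqP.
  by rewrite mulf_eq0 expf_eq0 invr_eq0 (negPf wi) andbF (negPf Qw).
move: qdef => <- /(congr1 (fun p => p.[0])).
rewrite hornerD hornerN !hornerM -polyC1 !hornerC.
rewrite on_line_horner scale0r addr0 Qy !mulr0 subr0.
by move/eqP; rewrite oner_eq0.
Qed.

(* On the surface, w = N B / L satisfies w ^ 2 + C w + B D = 0. *)
Lemma singular_line_not_normal (f B C D L N : {mpoly K[4]}) i
    (y z z' : 'rV[K]_4) :
  f = B * (N * N) + C * (L * N) + D * (L * L) ->
  y 0 i = 1 -> z 0 i = 0 -> z' 0 i = 0 ->
  on_line y z L = 0 -> on_line y z N = 'X ->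
  on_line y z' L = 'X -> on_line y z' N = 0 ->
  on_line y z f != 0 -> ~ normal_surface f.
Proof.
move=> fE yi zi z'i zL zN z'L z'N f_neq0 f_normal.
have X_neq0 : 'X != 0 :> {poly K} by rewrite polyX_eq0.
have zf : on_line y z f = on_line y z B * ('X * 'X).
  rewrite fE !on_lineD !on_lineM zL zN.
  by move: 'X (on_line y z B) (on_line y z C) (on_line y z D) => ? ? ? ?; ring.
have z'f : on_line y z' f = on_line y z' D * ('X * 'X).
  rewrite fE !on_lineD !on_lineM z'L z'N.
  by move: 'X (on_line y z' B) (on_line y z' C) (on_line y z' D) => ? ? ? ?; ring.
have fy : f.@[y 0] = 0.
  have := on_line_horner y z f 0; rewrite scale0r addr0 => <-.
  by rewrite zf !hornerM hornerX !mulr0.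
have [F [phi [phi0 phi_closed]]] := normal_chart_vanishing f_normal fy yi.
have phif : phi f = 0 by apply/phi0; exists 1, 0; rewrite mul1r mul0r addr0.
(* Along [z'] the form [L] restricts to the parameter and [f] to a multiple of its square, so [L] is
   not in the chart ideal. *)
have phiL : phi L != 0.
  apply/eqP => /phi0[u [v /(congr1 (on_line y z'))]].
  rewrite on_line_chart // z'L z'f => XE.
  have /(congr1 (fun p => p.[0])) : 1 = on_line y z' u * (on_line y z' D * 'X).
    apply: (mulIf X_neq0); rewrite mul1r [LHS]XE.
    by move: 'X (on_line y z' u) (on_line y z' D) => ? ? ?; ring.
  by rewrite !hornerM hornerX -polyC1 hornerC !mulr0 => /eqP; rewrite oner_eq0.
have [|r] := phi_closed (phi (N * B) / phi L) (ex_intro _ (N * B) (ex_intro _ L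
  (conj phiL erefl))).
  exists ('X^2 + C *: 'X + (B * D)%:P).
    rewrite monicE addrAC -addrA lead_coefDl ?lead_coefXn //.
    rewrite size_polyXn; apply: leq_ltn_trans (size_polyD _ _) _.
    rewrite gtn_max (leq_ltn_trans (size_polyC_leq1 _)) //=.
    by rewrite (leq_ltn_trans (size_scale_leq _ _)) ?size_polyX.
  rewrite rootE !rmorphD /= map_polyXn map_polyZ map_polyX map_polyC !hornerE.
  have : phi B * phi f = 0 by rewrite phif mulr0.
  rewrite fE !rmorphD !rmorphM /= => E.
  rewrite -(mulrI_eq0 _ (mulfI (expf_neq0 2 phiL))) -{}E; apply/eqP.
  by field.
(* If [w] were the class of some [r], then [N * B - r * L] would lie in the chart ideal. Along [z],
   where [L] is zero and [N] is the parameter, this makes ['X * b] a multiple of [b * 'X ^+ 2] with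
   [b] nonzero. *)
move=> /(congr1 (fun w => w * phi L)); rewrite divfK // -rmorphM => /eqP.
rewrite -subr_eq0 -rmorphB => /eqP/phi0[u [v /(congr1 (on_line y z))]].
rewrite on_line_chart // -mulN1r -mpolyC1 -mpolyCN on_lineD !on_lineM zL zN zf.
have : on_line y z B != 0.
  by apply: contraNneq f_neq0 => B0; rewrite zf B0 mul0r.
move: (on_line y z B) (on_line y z u) (on_line y z r) => b u' r' b_neq0 BE.
have /eqP : b * (1 - u' * 'X) = 0.
  apply: (mulfI X_neq0); rewrite mulr0.
  transitivity ('X * b + on_line y z (-1)%:MP * (r' * 0) - u' * (b * ('X * 'X))).
    by move: 'X (on_line _ _ _) => ? ?; ring.
  by rewrite BE subrr.
rewrite mulf_eq0 (negPf b_neq0) => /eqP/(congr1 (fun p => p.[0])).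
rewrite hornerD hornerN !hornerM hornerX -polyC1 !hornerC mulr0 subr0.
by move/eqP; rewrite oner_eq0.
Qed.

End Normality.

(** * The Igusa quartic and the Segre cubic in coordinates *)

Lemma sum6 (V : nmodType) (F : 'I_6 -> V) :
  \sum_(i < 6) F i =
  F 'o_0 + F 'o_1 + F 'o_2 + F 'o_3 + F 'o_4 + F 'o_5.
Proof.
rewrite !big_ord_recl big_ord0 addr0 !addrA.
by congr (_ + _ + _ + _ + _ + _); congr F; apply: val_inj.
Qed.

Lemma ord6P (P : 'I_6 -> Prop) :
  P 'o_0 -> P 'o_1 -> P 'o_2 -> P 'o_3 -> P 'o_4 -> P 'o_5 -> forall i, P i.
Proof.
by move=> ? ? ? ? ? ? [[|[|[|[|[|[|//]]]]]] lti]; rewrite (bool_irrelevance lti isT).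
Qed.

(* The span of the conic dual to the line zeta of the Segre cubic below: the point
   with n0 = al ^ 2, n1 = al * be, n2 = be ^ 2 has coordinates proportional to
   6 * zeta_i ^ 2 - \sum_j zeta_j ^ 2. *)
Definition trope_coord (R : comNzRingType) (p q n0 n1 n2 : R) (i : 'I_6) : R :=
  [:: p * (p - 1) * (q - 2%:R) * n0 + q * (q - 1) * (p + 1) * n2
      + (p ^+ 2 * q + p * q ^+ 2 - 2%:R * (p * q) ^+ 2 + 2%:R * p - q - 1) * n1;
      p * (p - 1) * (q + 1) * n0 + q * (q - 1) * (p - 2%:R) * n2
      + (p ^+ 2 * q + p * q ^+ 2 - 2%:R * (p * q) ^+ 2 - p + 2%:R * q - 1) * n1;
      p * (p - 1) * (q - 2%:R) * n0 + q * (q - 1) * (p - 2%:R) * n2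
      + ((p * q) ^+ 2 + p ^+ 2 * q + p * q ^+ 2 - 6%:R * (p * q)
         + 2%:R * p + 2%:R * q - 1) * n1;
      p * (p - 1) * (1 - 2%:R * q) * n0 + q * (q - 1) * (p + 1) * n2
      + ((p * q) ^+ 2 + p ^+ 2 * q - 2%:R * p * q ^+ 2 - p - q + 2%:R) * n1;
      p * (p - 1) * (q + 1) * n0 + q * (q - 1) * (1 - 2%:R * p) * n2
      + ((p * q) ^+ 2 - 2%:R * p ^+ 2 * q + p * q ^+ 2 - p - q + 2%:R) * n1;
      p * (p - 1) * (1 - 2%:R * q) * n0 + q * (q - 1) * (1 - 2%:R * p) * n2
      + ((p * q) ^+ 2 - 2%:R * p ^+ 2 * q - 2%:R * p * q ^+ 2 + 6%:R * (p * q)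
         - p - q - 1) * n1]`_i.

(* Points of a line of the Segre cubic: with b1 = - (zeta4 + zeta5),
   b2 = - (zeta3 + zeta5), b3 = - (zeta3 + zeta4), one has
   zeta1 + zeta2 = p * b1, zeta0 + zeta2 = q * b2, p * q * (zeta0 + zeta1) = b3. *)
Definition segre_coord (R : comNzRingType) (p q al be : R) (i : 'I_6) : R :=
  let b1 := (1 - p * q) * al in let b2 := (1 - p * q) * be in
  let c := (p - 1) * al + (q - 1) * be in
  [:: q * b2 - c - p * b1; p * b1 - c - q * b2; p * b1 + q * b2 + c;
      b1 - b2 + p * q * c; b2 - b1 + p * q * c; - (p * q) * c - b1 - b2]`_i.

(** The plane is tangent to the quartic along the conic [n1 ^+ 2 = n0 * n2], so the restricted form
    vanishes twice on it and must be a constant times a square. The [n] are used both as scalars and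
    as coordinate forms on the plane, hence the general ring. *)
Lemma igusa_trope_coord (R : comNzRingType) (p q n0 n1 n2 : R) :
  let x := trope_coord p q n0 n1 n2 in
  (\sum_i x i ^+ 2) ^+ 2 - 4%:R * (\sum_i x i ^+ 4) =
  - (18%:R * (p * q * (p - 1) * (q - 1) * (p * q - 1))) ^+ 2
  * (n1 ^+ 2 - n0 * n2) ^+ 2.
Proof. by rewrite /= !sum6 /trope_coord /=; ring. Qed.

(** * The gradient map and the lines of the Segre cubic *)

Section Gradient.
Variable K : fieldType.
Implicit Types x y : 'I_6 -> K.

Definition psum m x := \sum_(i < 6) x i ^+ m.

(* The vector of partial derivatives of the Igusa form at x, up to a scalar and
   up to the addition of a multiple of (1, .., 1) which makes its sum zero. *)
Definition gauss x (i : 'I_6) :=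
  12%:R * x i ^+ 3 - 3%:R * psum 2 x * x i - 2%:R * psum 3 x.

Definition on_igusa x := psum 1 x = 0 /\ psum 2 x ^+ 2 = 4%:R * psum 4 x.

Lemma psum_reindex m x (f : 'I_6 -> 'I_6) :
  injective f -> psum m (x \o f) = psum m x.
Proof. by move=> f_inj; rewrite /psum [RHS](reindex_inj f_inj). Qed.

Lemma gauss_reindex x (f : 'I_6 -> 'I_6) i :
  injective f -> gauss (x \o f) i = gauss x (f i).
Proof. by move=> f_inj; rewrite /gauss !psum_reindex. Qed.

Lemma on_igusa_reindex x (f : 'I_6 -> 'I_6) :
  injective f -> on_igusa x -> on_igusa (x \o f).
Proof. by move=> f_inj; rewrite /on_igusa !psum_reindex. Qed.

Lemma on_igusa_sum x : on_igusa x -> \sum_i x i = 0.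
Proof. by case=> x0 _; rewrite -[RHS]x0; apply: eq_bigr => i _; rewrite expr1. Qed.

Lemma sum_gauss x : on_igusa x -> \sum_i gauss x i = 0.
Proof.
rewrite /on_igusa /gauss /psum !sum6 => -[x0 _].
set s := (X in X = 0) in x0.
transitivity (- 3%:R * (x 'o_0 ^+ 2 + x 'o_1 ^+ 2 + x 'o_2 ^+ 2 + x 'o_3 ^+ 2 +
  x 'o_4 ^+ 2 + x 'o_5 ^+ 2) * s); first by rewrite /s; ring.
by rewrite x0 mulr0.
Qed.

Lemma sum_mul_gauss x : on_igusa x -> \sum_i gauss x i * x i = 0.
Proof.
case=> x0 xG; transitivity (12%:R * psum 4 x - 3%:R * psum 2 x ^+ 2 - 2%:R *
  psum 3 x * psum 1 x).
  by rewrite /gauss /psum !sum6; ring.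
by rewrite x0 xG; ring.
Qed.


(* Each coordinate t is a root of \prod_j (t - x_j); as 4 e4 = e2 ^ 2 on the
   quartic, 144 times this product is gauss ^ 2 up to an affine function of t. *)
Lemma sqr_gauss x : on_igusa x ->
  exists M N : K, forall i, gauss x i ^+ 2 = M * x i + N.
Proof.
rewrite /on_igusa /gauss.
have := erefl (psum 2 x); rewrite {2}/psum sum6; move: (psum 2 x) => p2.
have := erefl (psum 3 x); rewrite {2}/psum sum6; move: (psum 3 x) => p3.
rewrite /psum !sum6 !expr1.
move x0E: (x 'o_0) => x0; move x1E: (x 'o_1) => x1; move x2E: (x 'o_2) => x2.
move x3E: (x 'o_3) => x3; move x4E: (x 'o_4) => x4; move x5E: (x 'o_5) => x5.
move=> p3E p2E [/eqP]; rewrite addrC addr_eq0 => /eqP x5D xG.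
pose M := 144%:R * (x0 * x1 * x2 * x3 * (x4 + x5) +
  (x0 * x1 * (x2 + x3) + (x0 + x1) * x2 * x3) * x4 * x5) + 12%:R * p2 * p3.
pose N := 4%:R * p3 ^+ 2 - 144%:R * (x0 * x1 * x2 * x3 * x4 * x5).
have root_sqr t :
    (t - x0) * (t - x1) * (t - x2) * (t - x3) * (t - x4) * (t - x5) = 0 ->
    (12%:R * t ^+ 3 - 3%:R * p2 * t - 2%:R * p3) ^+ 2 = M * t + N.
  move=> t0; apply/eqP; rewrite -subr_eq0; apply/eqP.
  rewrite -[RHS](mulr0 144%:R) -t0 -[RHS]addr0 -(mulr0 (- 9%:R * t ^+ 2)).
  rewrite -[X in _ + _ * X](subrr (p2 ^+ 2)) {2}xG /M /N p2E p3E x5D; ring.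
exists M, N; elim/ord6P; rewrite ?x0E ?x1E ?x2E ?x3E ?x4E ?x5E;
  apply: root_sqr; ring.
Qed.

(** On the quartic, the square of [gauss x i + gauss x j] is -144 times the product of the six sums
    [x i + x l + x m] with [l], [m] different from [i] and [j]; up to sign these are the triple sums
    that separate [i] from [j]. *)
Lemma gauss_add_neq0 x i j : 2%:R != 0 :> K -> 3%:R != 0 :> K -> on_igusa x ->
  (forall l m n, uniq [:: l; m; n] -> x l + x m + x n != 0) ->
  i != j -> gauss x i + gauss x j != 0.
Proof.
move=> two_neq0 three_neq0 xI x_neq0 ij.
wlog [-> ->] : x i j ij xI x_neq0 / i = 'o_0 /\ j = 'o_1 => [IH|].
  pose j' := tperm 'o_0 i j; pose f z := tperm 'o_0 i (tperm 'o_1 j' z).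
  have f_inj : injective f by move=> u v /perm_inj/perm_inj.
  have j'_neq0 : j' != 'o_0.
    by rewrite /j' -(inj_eq (@perm_inj _ (tperm 'o_0 i))) tpermK tpermL eq_sym.
  have f0 : f 'o_0 = i by rewrite /f [tperm _ _ 'o_0]tpermD ?tpermL.
  have f1 : f 'o_1 = j by rewrite /f tpermL tpermK.
  rewrite -f0 -f1 -!gauss_reindex //; apply: (IH) => //.
    exact: on_igusa_reindex.
  by move=> l m n lmn; apply: x_neq0; rewrite -(map_inj_uniq f_inj) in lmn.
have h_neq0 : (x 'o_0 + x 'o_2 + x 'o_3) * (x 'o_0 + x 'o_2 + x 'o_4) *
    (x 'o_0 + x 'o_2 + x 'o_5) * (x 'o_0 + x 'o_3 + x 'o_4) *
    (x 'o_0 + x 'o_3 + x 'o_5) * (x 'o_0 + x 'o_4 + x 'o_5) != 0.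
  by rewrite !mulf_neq0 ?x_neq0.
have : - (12%:R ^+ 2) * ((x 'o_0 + x 'o_2 + x 'o_3) * (x 'o_0 + x 'o_2 + x 'o_4) *
    (x 'o_0 + x 'o_2 + x 'o_5) * (x 'o_0 + x 'o_3 + x 'o_4) *
    (x 'o_0 + x 'o_3 + x 'o_5) * (x 'o_0 + x 'o_4 + x 'o_5)) != 0.
  by rewrite mulf_neq0 // oppr_eq0 expf_neq0 // (natrM _ 4 3) (natrM _ 2 2)
    !mulf_neq0.
apply: contra_neq => g0; rewrite -[RHS](mulr0 (gauss x 'o_0 + gauss x 'o_1)) -g0.
case: xI; rewrite /gauss.
have := erefl (psum 2 x); rewrite {2}/psum sum6; move: (psum 2 x) => p2.
have := erefl (psum 3 x); rewrite {2}/psum sum6; move: (psum 3 x) => p3.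
rewrite /psum !sum6 !expr1.
move: (x 'o_0) (x 'o_1) (x 'o_2) (x 'o_3) (x 'o_4) (x 'o_5) => x0 x1 x2 x3 x4 x5.
move=> p3E p2E /eqP; rewrite addrC addr_eq0 => /eqP x5D xG.
apply/eqP; rewrite -subr_eq0; apply/eqP.
rewrite -(mulr0 (9%:R * (x0 - x1) ^+ 2)) -[X in _ = _ * X](subrr (p2 ^+ 2)) {2}xG.
rewrite p2E p3E x5D; ring.
Qed.


(** The coefficients in s of the sum of the cubes of [u i + s * v i], the middle two without their
    factor 3. *)
Definition on_segre_line (u v : 'I_6 -> K) :=
  [/\ \sum_i u i ^+ 3 = 0, \sum_i u i ^+ 2 * v i = 0,
      \sum_i u i * v i ^+ 2 = 0 & \sum_i v i ^+ 3 = 0].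

(** As the square of [gauss u] is affine in [u], its pairing with any vector of sum zero orthogonal
    to [u] is zero. Each coefficient is such a pairing. *)
Lemma segre_line x y : 2%:R != 0 :> K -> 3%:R != 0 :> K ->
  on_igusa x -> on_igusa y ->
  \sum_i gauss x i * y i = 0 -> \sum_i gauss y i * x i = 0 ->
  on_segre_line (gauss x) (gauss y).
Proof.
have key (u v : 'I_6 -> K) : 2%:R != 0 :> K -> 3%:R != 0 :> K -> on_igusa u ->
    \sum_i v i = 0 -> \sum_i v i * u i = 0 -> \sum_i gauss u i ^+ 2 * v i = 0.
  move=> two_neq0 three_neq0 /sqr_gauss[M [N uE]] v0 vu0.
  under eq_bigr => i _ do rewrite uE mulrDl -mulrA [u i * _]mulrC.
  by rewrite big_split /= -!mulr_sumr v0 vu0 !mulr0 addr0.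
move=> two_neq0 three_neq0 xI yI xy yx; split.
- under eq_bigr => i _ do rewrite exprSr.
  by apply: key => //; [exact: sum_gauss|exact: sum_mul_gauss].
- by apply: key => //; exact: sum_gauss.
- under eq_bigr => i _ do rewrite mulrC.
  by apply: key => //; exact: sum_gauss.
- under eq_bigr => i _ do rewrite exprSr.
  by apply: key => //; [exact: sum_gauss|exact: sum_mul_gauss].
Qed.

(* Unique factorization of (a1 + s * a1') * (a2 + s * a2') as a polynomial in s. *)
Lemma proportional_factors (c a1 a2 b1 b2 a1' a2' b1' b2' : K) :
  b1 != 0 -> b2 != 0 -> b1' != 0 -> b2' != 0 ->
  c * (a1 * a2) = b1 * b2 -> c * (a1' * a2') = b1' * b2' ->
  c * (a1 * a2' + a1' * a2) = b1 * b2' + b1' * b2 ->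
  (a1 * b1' = a1' * b1 /\ a2 * b2' = a2' * b2) \/
  (a1 * b2' = a1' * b2 /\ a2 * b1' = a2' * b1).
Proof.
move=> b1_neq0 b2_neq0 b1'_neq0 b2'_neq0 E E' Em.
have cofactor d1 d2 d1' d2' : d1 != 0 -> d1' != 0 -> c * (a1 * a2) = d1 * d2 ->
    c * (a1' * a2') = d1' * d2' -> a1 * d1' = a1' * d1 -> a2 * d2' = a2' * d2.
  move=> d1_neq0 d1'_neq0 F F' H; apply: (mulfI (mulf_neq0 d1_neq0 d1'_neq0)).
  transitivity (d1 * a2 * (d1' * d2')); first ring.
  transitivity (d1' * a2' * (d1 * d2)); last ring.
  rewrite -F -F'; transitivity (c * a2 * a2' * (a1' * d1)); first ring.
  by rewrite -H; ring.
have /eqP : (a1 * b1' - a1' * b1) * (a1 * b2' - a1' * b2) = 0.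
  transitivity (a1 ^+ 2 * (b1' * b2') + a1' ^+ 2 * (b1 * b2)
    - a1 * a1' * (b1 * b2' + b1' * b2)); first ring.
  by rewrite -E -E' -Em; ring.
rewrite mulf_eq0 !subr_eq0 => /orP[] /eqP H; [left|right]; split=> //.
  exact: cofactor b1_neq0 b1'_neq0 E E' H.
by apply: cofactor b2_neq0 b2'_neq0 _ _ H; rewrite ?E ?E' mulrC.
Qed.

(** The matched pair [a1], [b1] cancels from the identity of cubics in s and leaves two proportional
    products of two linear factors. *)
Lemma proportional_cofactors (a1 a2 a3 b1 b2 b3 a1' a2' a3' b1' b2' b3' : K) :
  [&& b1 != 0, b2 != 0 & b3 != 0] ->
  [&& b1' != 0, b2' != 0 & b3' != 0] ->
  a1 * a2 * a3 = - (b1 * b2 * b3) ->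
  a1' * a2 * a3 + a1 * a2' * a3 + a1 * a2 * a3' =
    - (b1' * b2 * b3 + b1 * b2' * b3 + b1 * b2 * b3') ->
  a1' * a2' * a3' = - (b1' * b2' * b3') ->
  a1 * b1' = a1' * b1 ->
  (a2 * b2' = a2' * b2 /\ a3 * b3' = a3' * b3) \/
  (a2 * b3' = a2' * b3 /\ a3 * b2' = a3' * b2).
Proof.
move=> /and3P[b1_neq0 b2_neq0 b3_neq0] /and3P[b1'_neq0 b2'_neq0 b3'_neq0].
move=> E Em E' E1.
pose c := - (a1 / b1).
have a1E : a1 = - c * b1 by rewrite opprK divfK.
have a1'E : a1' = - c * b1' by rewrite opprK mulrAC E1 mulfK.
have F : c * (a2 * a3) = b2 * b3.
  apply: (mulfI b1_neq0); apply: oppr_inj;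
    rewrite [b1 * (b2 * _)]mulrA -E {1}a1E; ring.
apply: (proportional_factors b2_neq0 b3_neq0 b2'_neq0 b3'_neq0 F).
  apply: (mulfI b1'_neq0); apply: oppr_inj;
    rewrite [b1' * (b2' * _)]mulrA -E' {1}a1'E; ring.
apply: (mulfI b1_neq0); apply: (addrI (b1' * (b2 * b3))); apply: oppr_inj.
transitivity (- (b1' * b2 * b3 + b1 * b2' * b3 + b1 * b2 * b3')); last ring.
by rewrite -Em -F {}a1E {}a1'E; ring.
Qed.

Definition segre_hyp (u v : 'I_6 -> K) :=
  [/\ on_segre_line u v, \sum_i u i = 0, \sum_i v i = 0,
      forall i j, i != j -> u i + u j != 0 &
      forall i j, i != j -> v i + v j != 0].

Lemma segre_hyp_reindex u v (f : 'I_6 -> 'I_6) : injective f ->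
  segre_hyp u v -> segre_hyp (u \o f) (v \o f).
Proof.
move=> f_inj [[uuu uuv uvv vvv] u0 v0 u_neq0 v_neq0].
split; try by rewrite -[RHS]u0 [RHS](reindex_inj f_inj).
- split; first by rewrite -[RHS]uuu [RHS](reindex_inj f_inj).
  + by rewrite -[RHS]uuv [RHS](reindex_inj f_inj).
  + by rewrite -[RHS]uvv [RHS](reindex_inj f_inj).
  + by rewrite -[RHS]vvv [RHS](reindex_inj f_inj).
- by rewrite -[RHS]v0 [RHS](reindex_inj f_inj).
- by move=> i j ij; apply: u_neq0; rewrite (inj_eq f_inj).
- by move=> i j ij; apply: v_neq0; rewrite (inj_eq f_inj).
Qed.

(* With sum zero, the Segre cubic reads
   (u1 + u2) (u0 + u2) (u0 + u1) = - (u4 + u5) (u3 + u5) (u3 + u4). *)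
Lemma segre_factors u v : 3%:R != 0 :> K -> segre_hyp u v ->
  let a1 := u 'o_1 + u 'o_2 in let a1' := v 'o_1 + v 'o_2 in
  let a2 := u 'o_0 + u 'o_2 in let a2' := v 'o_0 + v 'o_2 in
  let a3 := u 'o_0 + u 'o_1 in let a3' := v 'o_0 + v 'o_1 in
  let b1 := u 'o_4 + u 'o_5 in let b1' := v 'o_4 + v 'o_5 in
  let b2 := u 'o_3 + u 'o_5 in let b2' := v 'o_3 + v 'o_5 in
  let b3 := u 'o_3 + u 'o_4 in let b3' := v 'o_3 + v 'o_4 in
  [/\ a1 * a2 * a3 = - (b1 * b2 * b3),
    a1' * a2 * a3 + a1 * a2' * a3 + a1 * a2 * a3' =
      - (b1' * b2 * b3 + b1 * b2' * b3 + b1 * b2 * b3'),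
    a1 * a2' * a3' + a1' * a2 * a3' + a1' * a2' * a3 =
      - (b1 * b2' * b3' + b1' * b2 * b3' + b1' * b2' * b3) &
    a1' * a2' * a3' = - (b1' * b2' * b3')].
Proof.
move=> three_neq0 [[]]; rewrite !sum6 => uuu uuv uvv vvv /eqP.
rewrite addrC addr_eq0 => /eqP u5 /eqP; rewrite addrC addr_eq0 => /eqP v5 _ _ /=.
move: uuu uuv uvv vvv; rewrite u5 v5.
move: (u 'o_0) (u 'o_1) (u 'o_2) (u 'o_3) (u 'o_4) => u0 u1 u2 u3 u4.
move: (v 'o_0) (v 'o_1) (v 'o_2) (v 'o_3) (v 'o_4) => v0 v1 v2 v3 v4.
move=> uuu uuv uvv vvv.
have eqN a b c : a = 0 -> 3%:R * (b + c) = - a -> b = - c :> K.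
  move=> -> /eqP; rewrite oppr0 mulf_eq0 (negPf three_neq0) addr_eq0.
  by move/eqP.
split.
- by apply: (eqN _ _ _ uuu); ring.
- by apply: (eqN _ _ _ (etrans (congr1 (fun z => 3%:R * z) uuv) (mulr0 _))); ring.
- by apply: (eqN _ _ _ (etrans (congr1 (fun z => 3%:R * z) uvv) (mulr0 _))); ring.
- by apply: (eqN _ _ _ vvv); ring.
Qed.

Definition segre_ratios (u v : 'I_6 -> K) :=
  [/\ (u 'o_1 + u 'o_2) * (v 'o_4 + v 'o_5) = (v 'o_1 + v 'o_2) * (u 'o_4 + u 'o_5),
      (u 'o_0 + u 'o_2) * (v 'o_3 + v 'o_5) = (v 'o_0 + v 'o_2) * (u 'o_3 + u 'o_5) &
      (u 'o_0 + u 'o_1) * (v 'o_3 + v 'o_4) = (v 'o_0 + v 'o_1) * (u 'o_3 + u 'o_4)].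

(** Permuting the indices 3, 4, 5 permutes the three factors [b] and fixes the factors [a]; this
    brings the factor matching [a1] to the first place, and then orders the remaining two. *)
Lemma segre_line_ratios u v : 3%:R != 0 :> K -> segre_hyp u v ->
  exists2 f : 'I_6 -> 'I_6, injective f & segre_ratios (u \o f) (v \o f).
Proof.
move=> three_neq0.
have first_matched w z : segre_hyp w z ->
    (w 'o_1 + w 'o_2) * (z 'o_4 + z 'o_5) = (z 'o_1 + z 'o_2) * (w 'o_4 + w 'o_5) ->
    exists2 f : 'I_6 -> 'I_6, injective f & segre_ratios (w \o f) (z \o f).
  move=> wz E1; have [E Em _ E'] := segre_factors three_neq0 wz.
  have [_ _ _ w_neq0 z_neq0] := wz.
  have [||[E2 E3]|[E2 E3]] := proportional_cofactors _ _ E Em E' E1.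
  - by rewrite !w_neq0.
  - by rewrite !z_neq0.
  - by exists id.
  exists (tperm 'o_4 'o_5); first exact: perm_inj.
  rewrite /segre_ratios /= tpermL tpermR !tpermD //.
  by split=> //; rewrite [z 'o_5 + _]addrC E1 [w 'o_5 + _]addrC.
move=> uv; have [E Em Em' E'] := segre_factors three_neq0 uv.
have [_ _ _ u_neq0 v_neq0] := uv.
pose a := u 'o_1 + u 'o_2; pose a' := v 'o_1 + v 'o_2.
(* The product of the [b] factors, as a cubic in s, vanishes at the root of [a + s * a'].
   Homogenized, its value there is this product of determinants. *)
have : (a * (v 'o_4 + v 'o_5) - a' * (u 'o_4 + u 'o_5)) *
    (a * (v 'o_3 + v 'o_5) - a' * (u 'o_3 + u 'o_5)) *
    (a * (v 'o_3 + v 'o_4) - a' * (u 'o_3 + u 'o_4)) == 0.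
  move: E Em Em' E'; rewrite -/a -/a' => E Em Em' E'; apply/eqP.
  move: (u 'o_4 + _) (u 'o_3 + u 'o_5) (u 'o_3 + u 'o_4) E Em Em' => b1 b2 b3.
  move: (v 'o_4 + _) (v 'o_3 + v 'o_5) (v 'o_3 + v 'o_4) E' => b1' b2' b3'.
  move=> E' E Em Em'.
  transitivity (- a ^+ 3 * (- (b1' * b2' * b3'))
    + a ^+ 2 * a' * (- (b1 * b2' * b3' + b1' * b2 * b3' + b1' * b2' * b3))
    - a * a' ^+ 2 * (- (b1' * b2 * b3 + b1 * b2' * b3 + b1 * b2 * b3'))
    + a' ^+ 3 * (- (b1 * b2 * b3))); first ring.
  by rewrite -E -Em -Em' -E'; ring.
rewrite !mulf_eq0 !subr_eq0 => /orP[/orP[]|] /eqP E1.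
- exact: first_matched.
- have [|f f_inj fP] := first_matched (u \o tperm 'o_3 'o_4) (v \o tperm 'o_3 'o_4)
    (segre_hyp_reindex (@perm_inj _ _) uv).
    by rewrite /= tpermR !tpermD.
  exists (tperm 'o_3 'o_4 \o f) => //; exact: inj_comp (@perm_inj _ _) f_inj.
- have [|f f_inj fP] := first_matched (u \o tperm 'o_3 'o_5) (v \o tperm 'o_3 'o_5)
    (segre_hyp_reindex (@perm_inj _ _) uv).
    by rewrite /= tpermR !tpermD // [v 'o_4 + _]addrC E1 [u 'o_4 + _]addrC.
  exists (tperm 'o_3 'o_5 \o f) => //; exact: inj_comp (@perm_inj _ _) f_inj.
Qed.

(** A cubic map on a conic has degree 6 in [al], [be]. The point of the line accounts for one
    degree; the rest is a binary quintic whose zeros are the points of the conic where the gradient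
    vanishes. *)
Lemma gauss_trope_coord (p q al be : K) i :
  gauss (trope_coord p q (al ^+ 2) (al * be) (be ^+ 2)) i =
  - 162%:R * (p * q * (p - 1) * (q - 1) * al * be) *
  (((p - 1) * al + (q - 1) * be) * (be - p * al) * (al - q * be)) *
  segre_coord p q al be i.
Proof. by elim/ord6P: i;
  rewrite /gauss /psum !sum6 /trope_coord /segre_coord /=; ring. Qed.

Lemma trope_coord_sum (p q n0 n1 n2 : K) : \sum_i trope_coord p q n0 n1 n2 i = 0.
Proof. by rewrite sum6 /trope_coord /=; ring. Qed.

(** There is no condition on the [n]: the whole plane, not only its conic, is orthogonal to the
    line. *)
Lemma segre_trope_coord (p q al be n0 n1 n2 : K) :
  \sum_i segre_coord p q al be i * trope_coord p q n0 n1 n2 i = 0.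
Proof. by rewrite sum6 /segre_coord /trope_coord /=; ring. Qed.

Lemma segre_coord_trope (p q al be : K) i :
  6%:R * segre_coord p q al be i ^+ 2 - \sum_j segre_coord p q al be j ^+ 2 =
  8%:R * (p * q - 1) * trope_coord p q (al ^+ 2) (al * be) (be ^+ 2) i.
Proof. by elim/ord6P: i; rewrite sum6 /segre_coord /trope_coord /=; ring. Qed.

Lemma segre_param (w : 'I_6 -> K) p q : p * q != 1 -> \sum_i w i = 0 ->
  w 'o_1 + w 'o_2 = - (p * (w 'o_4 + w 'o_5)) ->
  w 'o_0 + w 'o_2 = - (q * (w 'o_3 + w 'o_5)) ->
  p * q * (w 'o_0 + w 'o_1) = - (w 'o_3 + w 'o_4) ->
  exists al be, forall i, 2%:R * w i = segre_coord p q al be i.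
Proof.
move=> pq1 w0 E1 E2 E3; have pq_neq0 : 1 - p * q != 0 by rewrite subr_eq0 eq_sym.
pose al := - (w 'o_4 + w 'o_5) / (1 - p * q).
pose be := - (w 'o_3 + w 'o_5) / (1 - p * q).
have b1E : (1 - p * q) * al = - (w 'o_4 + w 'o_5) by rewrite mulrC divfK.
have b2E : (1 - p * q) * be = - (w 'o_3 + w 'o_5) by rewrite mulrC divfK.
have a1E : p * ((1 - p * q) * al) = w 'o_1 + w 'o_2 by rewrite b1E E1 mulrN.
have a2E : q * ((1 - p * q) * be) = w 'o_0 + w 'o_2 by rewrite b2E E2 mulrN.
have cE : (p - 1) * al + (q - 1) * be = - (w 'o_0 + w 'o_1).
  apply: (mulfI pq_neq0).
  transitivity (p * ((1 - p * q) * al) + q * ((1 - p * q) * be)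
    - (1 - p * q) * al - (1 - p * q) * be); first ring.
  rewrite a1E a2E b1E b2E;
    transitivity (- (w 'o_0 + w 'o_1) + p * q * (w 'o_0 + w 'o_1)).
    rewrite E3; apply/eqP; rewrite -subr_eq0 -[X in _ == X](mulr0 2%:R) -w0 sum6.
    by apply/eqP; ring.
  ring.
exists al, be; elim/ord6P;
  rewrite /segre_coord /= cE ?a1E ?a2E ?b1E ?b2E ?mulrN ?mulNr ?opprK ?E3;
  ring.
Qed.

(* The dual variety of the quartic is the Segre cubic, whose polar map sends
   gauss x back to x. *)
Lemma gauss_inv x : 2%:R != 0 :> K -> 3%:R != 0 :> K -> on_igusa x ->
  (forall i j, i != j -> gauss x i + gauss x j != 0) ->
  exists2 c, c != 0 &
    forall i, c * x i = 6%:R * gauss x i ^+ 2 - \sum_j gauss x j ^+ 2.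
Proof.
move=> two_neq0 three_neq0 xI g_neq0.
have six_neq0 : 6%:R != 0 :> K by rewrite (natrM _ 2 3) mulf_neq0.
have [M [N gE]] := sqr_gauss xI.
have gS : \sum_j gauss x j ^+ 2 = 6%:R * N.
  under eq_bigr => j _ do rewrite gE.
  rewrite big_split /= -mulr_sumr (on_igusa_sum xI) mulr0 add0r.
  by rewrite sumr_const card_ord mulr_natl.
exists (6%:R * M); last by move=> i; rewrite gS gE; ring.
(* With [M = 0] all the squares agree. As no two coordinates are opposite, all coordinates are
   equal, and their sum being zero makes them vanish. *)
apply: mulf_neq0 => //; apply/eqP => M0.
have gg i j : gauss x i = gauss x j.
  have [->//|ij] := eqVneq i j; apply: subr0_eq.
  by apply: (mulIf (g_neq0 _ _ ij)); rewrite mul0r -subr_sqr !gE M0 !mul0r subrr.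
have := sum_gauss xI; rewrite (eq_bigr (fun=> gauss x 'o_0)) => [|i _];
  last exact: gg.
rewrite sumr_const card_ord -[_ *+ _]mulr_natl => /eqP;
  rewrite mulf_eq0 (negPf six_neq0) /=.
move=> /eqP g0; have := g_neq0 'o_0 'o_1 isT.
by rewrite (gg 'o_1 'o_0) g0 addr0 eqxx.
Qed.

Definition trope_param p q x := exists al be l,
  l != 0 /\ forall i, x i = l * trope_coord p q (al ^+ 2) (al * be) (be ^+ 2) i.

Lemma trope_param_exists x p q : 2%:R != 0 :> K -> 3%:R != 0 :> K -> p * q != 1 ->
  on_igusa x -> (forall i j, i != j -> gauss x i + gauss x j != 0) ->
  gauss x 'o_1 + gauss x 'o_2 = - (p * (gauss x 'o_4 + gauss x 'o_5)) ->
  gauss x 'o_0 + gauss x 'o_2 = - (q * (gauss x 'o_3 + gauss x 'o_5)) ->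
  p * q * (gauss x 'o_0 + gauss x 'o_1) = - (gauss x 'o_3 + gauss x 'o_4) ->
  trope_param p q x.
Proof.
move=> two_neq0 three_neq0 pq1 xI g_neq0 E1 E2 E3.
have [al [be gE]] := segre_param pq1 (sum_gauss xI) E1 E2 E3.
have [c c_neq0 cE] := gauss_inv two_neq0 three_neq0 xI g_neq0.
have pq_neq0 : p * q - 1 != 0 by rewrite subr_eq0.
exists al, be, (2%:R * (p * q - 1) / c); split.
  by rewrite !mulf_neq0 ?invr_eq0.
move=> i; apply: (mulfI c_neq0); apply: (mulfI two_neq0); apply: (mulfI two_neq0).
rewrite cE; transitivity (8%:R * (p * q - 1) * trope_coord p q (al ^+ 2) (al *
  be) (be ^+ 2) i).
  rewrite -segre_coord_trope -gE.
  under [X in _ = _ - X]eq_bigr => j _ do rewrite -gE exprMn.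
  by rewrite -mulr_sumr; ring.
by field.
Qed.

Lemma common_trope x y : 2%:R != 0 :> K -> 3%:R != 0 :> K ->
  on_igusa x -> on_igusa y ->
  (forall l m n, uniq [:: l; m; n] -> x l + x m + x n != 0) ->
  (forall l m n, uniq [:: l; m; n] -> y l + y m + y n != 0) ->
  \sum_i gauss x i * y i = 0 -> \sum_i gauss y i * x i = 0 ->
  exists (f : 'I_6 -> 'I_6) p q,
    [/\ injective f, p * q * (p - 1) * (q - 1) * (p * q - 1) != 0,
        trope_param p q (x \o f) & trope_param p q (y \o f)].
Proof.
move=> two_neq0 three_neq0 xI yI x_neq0 y_neq0 xy yx.
have gx_neq0 i j : i != j -> gauss x i + gauss x j != 0 by exact: gauss_add_neq0.
have gy_neq0 i j : i != j -> gauss y i + gauss y j != 0 by exact: gauss_add_neq0.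
have H : segre_hyp (gauss x) (gauss y).
  by split; [exact: segre_line|exact: sum_gauss|exact: sum_gauss| |].
have [f f_inj fR] := segre_line_ratios three_neq0 H.
have {}H := segre_hyp_reindex f_inj H; exists f.
have [E _ _ E'] := segre_factors three_neq0 H.
have [_ U0 V0 U_neq0 V_neq0] := H.
have gxf i := gauss_reindex x i f_inj; have gyf i := gauss_reindex y i f_inj.
set U := gauss x \o f in U0 U_neq0 E fR; set V := gauss y \o f in V0 V_neq0 E' fR.
pose p := - ((U 'o_1 + U 'o_2) / (U 'o_4 + U 'o_5)).
pose q := - ((U 'o_0 + U 'o_2) / (U 'o_3 + U 'o_5)).
have Up : U 'o_1 + U 'o_2 = - (p * (U 'o_4 + U 'o_5)) by rewrite mulNr opprK
  divfK ?U_neq0.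
have Uq : U 'o_0 + U 'o_2 = - (q * (U 'o_3 + U 'o_5)) by rewrite mulNr opprK
  divfK ?U_neq0.
have [R1 R2 R3] := fR.
have Vp : V 'o_1 + V 'o_2 = - (p * (V 'o_4 + V 'o_5)).
  by rewrite mulNr opprK mulrAC R1 mulfK ?U_neq0.
have Vq : V 'o_0 + V 'o_2 = - (q * (V 'o_3 + V 'o_5)).
  by rewrite mulNr opprK mulrAC R2 mulfK ?U_neq0.
(* The cubic equation makes the product of the three ratios, with their signs, equal to 1. *)
have third (W : 'I_6 -> K) : (forall i j, i != j -> W i + W j != 0) ->
   W 'o_1 + W 'o_2 = - (p * (W 'o_4 + W 'o_5)) ->
   W 'o_0 + W 'o_2 = - (q * (W 'o_3 + W 'o_5)) ->
   (W 'o_1 + W 'o_2) * (W 'o_0 + W 'o_2) * (W 'o_0 + W 'o_1) =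
     - ((W 'o_4 + W 'o_5) * (W 'o_3 + W 'o_5) * (W 'o_3 + W 'o_4)) ->
   p * q * (W 'o_0 + W 'o_1) = - (W 'o_3 + W 'o_4).
  move=> W_neq0 -> -> EW.
  apply: (mulfI (W_neq0 'o_4 'o_5 isT)); apply: (mulfI (W_neq0 'o_3 'o_5 isT)).
  apply: etrans (etrans EW _); ring.
have p_neq0 : p != 0 by rewrite oppr_eq0 mulf_neq0 ?invr_eq0 ?U_neq0.
have q_neq0 : q != 0 by rewrite oppr_eq0 mulf_neq0 ?invr_eq0 ?U_neq0.
have U3 := third U U_neq0 Up Uq E; have V3 := third V V_neq0 Vp Vq E'.
have U5 : U 'o_5 = - (U 'o_0 + U 'o_1 + U 'o_2 + U 'o_3 + U 'o_4).
  by apply/eqP; rewrite -addr_eq0 addrC -[X in _ == X]U0 sum6.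
(* For [p], [q] or [p * q] equal to 1, a sum of four coordinates vanishes, hence also the sum of the
   other two. *)
have p1 : p != 1.
  apply: contra_neq (U_neq0 'o_0 'o_3 isT) => p1; move: Up; rewrite p1 U5 mul1r.
  move/eqP; rewrite -subr_eq0 => /eqP U12; apply: oppr_inj; rewrite oppr0 -U12; ring.
have q1 : q != 1.
  apply: contra_neq (U_neq0 'o_1 'o_4 isT) => q1; move: Uq; rewrite q1 U5 mul1r.
  move/eqP; rewrite -subr_eq0 => /eqP U12; apply: oppr_inj; rewrite oppr0 -U12; ring.
have pq1 : p * q != 1.
  apply: contra_neq (U_neq0 'o_2 'o_5 isT) => pq1; move: U3; rewrite pq1 U5 mul1r.
  move/eqP; rewrite -subr_eq0 => /eqP U12; apply: oppr_inj; rewrite oppr0 -U12; ring.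
exists p, q; split=> //; first by rewrite !mulf_neq0 ?subr_eq0.
  apply: trope_param_exists => //; rewrite ?gxf //; first exact: on_igusa_reindex.
  by move=> i j ij; rewrite !gxf; apply: U_neq0.
apply: trope_param_exists => //; rewrite ?gyf //; first exact: on_igusa_reindex.
by move=> i j ij; rewrite !gyf; apply: V_neq0.
Qed.

End Gradient.

(** * Tangent sections of the Igusa quartic *)

Section Model.
Variable K : fieldType.

Lemma row_free_colr m n (A : 'M[K]_(m, n)) (r : 'rV_n) :
  row_free A -> ~~ (r <= A)%MS -> row_free (col_mx A r).
Proof.
move=> A_free rA; rewrite -row_leq_rank.
have sub : (A <= col_mx A r)%MS by rewrite -addsmxE addsmxSl.
have : (\rank A < \rank (col_mx A r))%N.
  rewrite ltn_neqAle mxrankS // andbT; apply: contra rA.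
  rewrite (mxrank_leqif_eq sub) => /andP[_]; apply: submx_trans.
  by rewrite -addsmxE addsmxSr.
by rewrite (eqP A_free) -(addn1 m).
Qed.

Lemma exists_row_free_colr m n l (A : 'M[K]_(m, n)) (P : 'M_(l, n)) :
  row_free A -> (m < \rank P)%N ->
  exists2 r : 'rV_n, (r <= P)%MS & row_free (col_mx A r).
Proof.
move=> A_free ltmP.
have /row_subPn[i iA] : ~~ (P <= A)%MS.
  by apply: contraL ltmP => /mxrankS; rewrite -leqNgt => /leq_trans; apply;
    exact: rank_leq_row.
by exists (row i P); [exact: row_sub|exact: row_free_colr].
Qed.

Lemma mderivXn n (f : {mpoly K[n]}) i m :
  (f ^+ m)^`M(i) = m%:R *: (f ^+ m.-1 * f^`M(i)).
Proof.
elim: m => [|m IHm]; first by rewrite expr0 scale0r -mpolyC1 mderivC.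
rewrite exprS mderivM IHm -natr1 scalerDl scale1r addrC /=.
congr (_ + _); last by rewrite mulrC.
by case: m {IHm} => [|m]; rewrite ?scale0r ?mulr0 // exprS -scalerAr mulrA.
Qed.

Lemma polar_igusa (x y : 'rV[K]_6) :
  polar (igusa_form K) x y =
  \sum_i (4%:R * psum 2 (x 0) * x 0 i - 16%:R * x 0 i ^+ 3) * y 0 i.
Proof.
have dsum m i : ((\sum_(j < 6) 'X_j ^+ m : {mpoly K[6]})^`M(i)).@[x 0] =
    m%:R * x 0 i ^+ m.-1.
  rewrite (big_morph _ (mderivD i) (mderiv0 _ i)) (bigD1 i) //= big1 => [|j ji].
    by rewrite addr0 mderivXn mderivXU eqxx mulr1 mevalZ rmorphXn /= mevalXU.
  by rewrite mderivXn mderivXU eq_sym (negPf ji) mulr0 scaler0.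
apply: eq_bigr => i _; congr (_ * _).
rewrite /igusa_form mderivB mderivZ mderivXn mevalB !mevalZ mevalM !dsum expr1.
have -> : (\sum_(j < 6) 'X_j ^+ 2 : {mpoly K[6]}).@[x 0] = psum 2 (x 0).
  by rewrite raddf_sum /=; apply: eq_bigr => j _; rewrite rmorphXn /= mevalXU.
rewrite /=; ring.
Qed.

Variables (F : {mpoly K[5]}).

Definition igusa_model (M : 'M[K]_(5, 6)) c :=
  [/\ row_free M, forall i, \sum_(j < 6) M i j = 0, c != 0 &
      F = c *: section (igusa_form K) M].



Definition ideal_sq (R : comNzRingType) (N L f : R) :=
  exists B C D, f = B * (N * N) + C * (L * N) + D * (L * L).

Lemma ideal_sq0 (R : comNzRingType) (N L : R) : ideal_sq N L 0.
Proof. by exists 0, 0, 0; rewrite !mul0r !addr0. Qed.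

Lemma ideal_sqD (R : comNzRingType) (N L f g : R) :
  ideal_sq N L f -> ideal_sq N L g -> ideal_sq N L (f + g).
Proof.
move=> [B [C [D ->]]] [B' [C' [D' ->]]]; exists (B + B'), (C + C'), (D + D'); ring.
Qed.

Lemma ideal_sqM (R : comNzRingType) (N L f g : R) :
  ideal_sq N L f -> ideal_sq N L (g * f).
Proof. by move=> [B [C [D ->]]]; exists (g * B), (g * C), (g * D); ring. Qed.

Lemma ideal_sq_sum (R : comNzRingType) (N L : R) I (r : seq I) (f : I -> R) :
  (forall i, ideal_sq N L (f i)) -> ideal_sq N L (\sum_(i <- r) f i).
Proof.
move=> fI; apply: (big_ind (ideal_sq N L)) => // [|g h]; last exact: ideal_sqD.
exact: ideal_sq0.
Qed.

(** Taylor expansion at [s * x]: the terms of order 0 and 1 in [w] vanish by hypothesis, and all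
    others are displayed as combinations of products [w i * w j], which lie in the square of the
    ideal of [N] and [L]. *)
Lemma igusa_tangent_ideal (R : comNzRingType) (s N L : R) (x z z' : 'I_6 -> R) :
  let G y := (\sum_i y i ^+ 2) ^+ 2 - 4%:R * \sum_i y i ^+ 4 in
  let P y := \sum_i (4%:R * (\sum_j x j ^+ 2) * x i - 16%:R * x i ^+ 3) * y i in
  G x = 0 -> P z = 0 -> P z' = 0 ->
  ideal_sq N L (G (fun i => s * x i + (N * z i + L * z' i))).
Proof.
move=> G P Gx Pz Pz'; pose w i := N * z i + L * z' i.
have ww i j : ideal_sq N L (w i * w j).
  by exists (z i * z j), (z i * z' j + z' i * z j), (z' i * z' j); rewrite /w; ring.
have Sww : ideal_sq N L (\sum_i w i * w i) by apply: ideal_sq_sum.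
have Sxw : ideal_sq N L ((\sum_i x i * w i) * (\sum_i x i * w i)).
  rewrite mulr_suml; apply: ideal_sq_sum => i; rewrite mulr_sumr.
  apply: ideal_sq_sum => j; rewrite (_ : _ * _ = x i * x j * (w i * w j)); last ring.
  exact: ideal_sqM.
have -> : G (fun i => s * x i + w i) =
    s ^+ 4 * G x + s ^+ 3 * (N * P z + L * P z') +
    (s ^+ 2 * (4%:R * ((\sum_i x i * w i) * (\sum_i x i * w i))
              + 2%:R * (\sum_i x i ^+ 2) * (\sum_i w i * w i)
              + - 24%:R * \sum_i (x i ^+ 2 * (w i * w i)))
     + (s * (4%:R * (\sum_i x i * w i) * (\sum_i w i * w i)
            + - 16%:R * \sum_i (x i * w i * (w i * w i)))
        + ((\sum_i w i * w i) * (\sum_i w i * w i)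
          + - 4%:R * \sum_i (w i * w i * (w i * w i))))).
  have -> : N * P z + L * P z' =
      \sum_i (4%:R * (\sum_j x j ^+ 2) * x i - 16%:R * x i ^+ 3) * w i.
    by rewrite !mulr_sumr -big_split; apply: eq_bigr => i _; rewrite /w /=; ring.
  have sq : \sum_i (s * x i + w i) ^+ 2 = s ^+ 2 * (\sum_i x i ^+ 2)
      + 2%:R * s * (\sum_i x i * w i) + \sum_i w i * w i by rewrite !sum6; ring.
  have quart : \sum_i (s * x i + w i) ^+ 4 = s ^+ 4 * (\sum_i x i ^+ 4)
      + 4%:R * s ^+ 3 * (\sum_i x i ^+ 3 * w i)
      + 6%:R * s ^+ 2 * (\sum_i x i ^+ 2 * (w i * w i))
      + 4%:R * s * (\sum_i x i * w i * (w i * w i))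
      + \sum_i (w i * w i * (w i * w i)) by rewrite !sum6; ring.
  have -> : \sum_i (4%:R * (\sum_j x j ^+ 2) * x i - 16%:R * x i ^+ 3) * w i =
      4%:R * (\sum_j x j ^+ 2) * (\sum_i x i * w i) - 16%:R * (\sum_i x i ^+ 3 * w i).
    by rewrite !mulr_sumr -sumrB; apply: eq_bigr => i _; ring.
  rewrite /G sq quart.
  move: (\sum_i x i ^+ 2) (\sum_i x i ^+ 4) (\sum_i x i * w i) (\sum_i w i * w i).
  move: (\sum_i x i ^+ 3 * w i) (\sum_i x i ^+ 2 * (w i * w i)).
  move: (\sum_i x i * w i * (w i * w i)) (\sum_i w i * w i * (w i * w i)).
  by move=> *; ring.
rewrite Gx Pz Pz' !mulr0 !addr0 mulr0 add0r.
by repeat first [exact: ideal_sq0 | exact: Sww | exact: Sxw | exact: ww |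
  apply: ideal_sqD
  | apply: ideal_sqM | apply: ideal_sq_sum => ?].
Qed.

Lemma igusa_tangent_ideal_map (R : comNzRingType) (phi : {rmorphism K -> R})
    (s N L : R) (x z z' : 'I_6 -> K) :
  let G (y : 'I_6 -> R) := (\sum_i y i ^+ 2) ^+ 2 - 4%:R * \sum_i y i ^+ 4 in
  let P y := \sum_i (4%:R * (\sum_j x j ^+ 2) * x i - 16%:R * x i ^+ 3) * y i in
  (\sum_i x i ^+ 2) ^+ 2 - 4%:R * (\sum_i x i ^+ 4) = 0 -> P z = 0 -> P z' = 0 ->
  ideal_sq N L (G (fun i => s * phi (x i) + (N * phi (z i) + L * phi (z' i)))).
Proof.
move=> G P Gx Pz Pz'; apply: igusa_tangent_ideal.
- rewrite -[RHS](rmorph0 phi) -[in RHS]Gx !sum6; ring.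
- rewrite -[RHS](rmorph0 phi) -[in RHS]Pz /P !sum6; ring.
- rewrite -[RHS](rmorph0 phi) -[in RHS]Pz' /P !sum6; ring.
Qed.

(** When the sum is zero, the sum of cubes is a multiple of 3. In characteristic 3 the translation
    therefore changes neither the sum of squares nor that of fourth powers. *)
Lemma igusa_shift_char3 (R : comNzRingType) (t : R) (y : 'I_6 -> R) :
  let G y := (\sum_i y i ^+ 2) ^+ 2 - 4%:R * \sum_i y i ^+ 4 in
  3%:R = 0 :> R -> \sum_i y i = 0 -> G (fun i => t + y i) = G y.
Proof.
move=> G three0; rewrite sum6 => /eqP; rewrite addrC addr_eq0 => /eqP y5.
apply: subr0_eq; rewrite /G !sum6 y5.
move: (y 'o_0) (y 'o_1) (y 'o_2) (y 'o_3) (y 'o_4) => y0 y1 y2 y3 y4.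
rewrite -[RHS](mul0r (4%:R * t ^+ 4 - 4%:R * t ^+ 2 *
  (y0 ^+ 2 + y1 ^+ 2 + y2 ^+ 2 + y3 ^+ 2 + y4 ^+ 2 + (y0 + y1 + y2 + y3 + y4) ^+ 2)
  + 16%:R * t * ((y1 + y2) * (y0 + y2) * (y0 + y1) +
    (y0 + y1 + y2 + y3) * (y0 + y1 + y2 + y4) * (y3 + y4)))) -three0; ring.
Qed.

Section Points.
Variables (M : 'M[K]_(5, 6)) (c : K).
Hypothesis FM : igusa_model M c.

Lemma model_sum m (A : 'M_(m, 5)) i : \sum_j (A *m M) i j = 0.
Proof.
case: FM => _ M0 _ _; under eq_bigr => j _ do rewrite mxE.
by rewrite exchange_big big1 //= => l _; rewrite -mulr_sumr M0 mulr0.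
Qed.

Lemma model_eval (a : 'rV_5) :
  F.@[a 0] = c * (psum 2 ((a *m M) 0) ^+ 2 - 4%:R * psum 4 ((a *m M) 0)).
Proof.
case: FM => _ _ _ ->; rewrite mevalZ section_meval /igusa_form; congr (_ * _).
rewrite mevalB mevalZ rmorphXn /= !raddf_sum /psum /=.
by congr (_ ^+ 2 - _ * _); apply: eq_bigr => j _; rewrite rmorphXn /= mevalXU.
Qed.

Lemma model_on_igusa (a : 'rV_5) : F.@[a 0] = 0 -> on_igusa ((a *m M) 0).
Proof.
rewrite model_eval => /eqP; case: FM => _ _ c_neq0 _.
rewrite mulf_eq0 (negPf c_neq0) subr_eq0 => /eqP E; split=> //.
rewrite /psum -[RHS](model_sum a 0).
by apply: eq_bigr => i _; rewrite expr1.
Qed.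

Lemma model_polar (a b : 'rV_5) : polar F a b = c *
  \sum_i (4%:R * psum 2 ((a *m M) 0) * (a *m M) 0 i - 16%:R * (a *m M) 0 i ^+ 3)
  * (b *m M) 0 i.
Proof.
case: FM => _ _ _ ->; rewrite -polar_igusa -polar_section /polar mulr_sumr.
by apply: eq_bigr => i _; rewrite mderivZ mevalZ mulrA.
Qed.

(** [- 4 * gauss] is 3 times the gradient up to a constant vector, and constant vectors pair to zero
    with the hyperplane. *)
Lemma model_polar_gauss (a b : 'rV_5) : 3%:R * polar F a b =
  - (4%:R * c) * \sum_i gauss ((a *m M) 0) i * (b *m M) 0 i.
Proof.
rewrite model_polar mulrA mulr_sumr [RHS]mulr_sumr; apply: subr0_eq.
rewrite -sumrB.
transitivity (\sum_i - (8%:R * c * psum 3 ((a *m M) 0)) * (b *m M) 0 i).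
  by apply: eq_bigr => i _; rewrite /gauss; ring.
by rewrite -mulr_sumr model_sum mulr0.
Qed.

Lemma model_lift m (V : 'M_(m, 6)) :
  (forall i, \sum_j V i j = 0) -> exists A, V = A *m M.
Proof.
move=> V0; apply/submxP; case: FM => M_free M0 _ _.
have sub n (A : 'M[K]_(n, 6)) : (forall i, \sum_j A i j = 0) ->
    (A <= kermx (const_mx 1 : 'cV_6))%MS.
  move=> A0; apply/sub_kermxP/matrixP => i j; rewrite !mxE -[RHS](A0 i).
  by apply: eq_bigr => l _; rewrite mxE mulr1.
apply: submx_trans (sub _ _ V0) _.
rewrite -(geq_leqif (mxrank_leqif_sup (sub _ _ M0))) mxrank_ker (eqP M_free).
rewrite leq_subLR addnC -ltnS -addSn (leq_add2l 6 1) lt0n mxrank_eq0.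
by apply/eqP => /matrixP/(_ 0 0)/eqP; rewrite !mxE oner_eq0.
Qed.

(** The symmetric group acts on the model and leaves the points in place, so any choice of indices
    can be moved to a standard one. *)
Lemma model_reindex (f : 'I_6 -> 'I_6) : injective f -> igusa_model (colsub f M) c.
Proof.
move=> f_inj; case: FM => M_free M0 c_neq0 FE; split.
- have [g fK gK] := injF_bij f_inj.
  have ME : M = colsub g (colsub f M) by apply/matrixP => i j; rewrite !mxE gK.
  rewrite -kermx_eq0; apply/eqP; set A := kermx _.
  have /(congr1 (colsub g)) : A *m colsub f M = 0 by exact: mulmx_ker.
  rewrite -mulmx_colsub -ME => AM; apply: (row_free_inj M_free).
  by rewrite AM mul0mx; apply/matrixP => i j; rewrite !mxE.
- move=> i; rewrite -[RHS](M0 i) [RHS](reindex_inj f_inj).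
  by apply: eq_bigr => j _; rewrite mxE.
- exact: c_neq0.
- rewrite FE !section_igusa; congr (_ *: (_ ^+ 2 - _ *: _)).
    rewrite (reindex_inj f_inj); apply: eq_bigr => i _.
    by congr (_ ^+ 2); apply: eq_bigr => j _; rewrite mxE.
  rewrite (reindex_inj f_inj); apply: eq_bigr => i _.
  by congr (_ ^+ 4); apply: eq_bigr => j _; rewrite mxE.
Qed.


Lemma model_polar_self (a : 'rV_5) : F.@[a 0] = 0 -> polar F a a = 0.
Proof.
move=> Fa; rewrite -[RHS](mulr0 4%:R) -Fa model_polar model_eval mulrCA;
  congr (_ * _).
move: ((a *m M) 0) => x; transitivity (4%:R * psum 2 x * psum 2 x - 16%:R * psum 4 x).
  rewrite [X in _ = _ * X - _]/psum [psum 4 x]/psum !mulr_sumr -sumrB.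
  by apply: eq_bigr => i _; ring.
by ring.
Qed.

Lemma tangent_hyperplane (a : 'rV_5) (B : 'M_(4, 5)) :
  row_free B -> (B == tangent F a)%MS -> exists b, polar F a b != 0.
Proof.
move=> B_free /eqmxP BT.
have /row_subPn[i] : ~~ (1%:M <= tangent F a)%MS.
  by apply/negP => /mxrankS; rewrite mxrank1 -BT (eqP B_free).
move=> iT; exists (row i 1%:M); apply: contra iT => /eqP Fi.
by apply/sub_tangent => j; rewrite row_id.
Qed.

Lemma igusa_section_coord m (B : 'M_(m, 5)) : section F B =
  c *: ((\sum_i (section 'X_i (B *m M)) ^+ 2) ^+ 2
        - 4%:R *: (\sum_i (section 'X_i (B *m M)) ^+ 4)).
Proof.
case: FM => _ _ _ ->; rewrite sectionZ section_section section_igusa.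
by congr (_ *: (_ ^+ 2 - _ *: _)); apply: eq_bigr => i _; rewrite sectionX.
Qed.

Lemma section_linear m n (B : 'M[K]_(m, n)) i : section 'X_i B \is 1.-homog.
Proof.
rewrite sectionX; apply: rpred_sum => j _; apply: rpredZ.
by rewrite dhomogX /= mdeg1.
Qed.

(* On x0 + x1 + x2 = 0 the quartic is minus 4 times the square of Q below. *)
Lemma normal_sum3_neq0 (a : 'rV_5) (B : 'M_(4, 5)) :
  (forall p : {poly K}, p != 0 -> exists x, p.[x] != 0) -> 2%:R != 0 :> K ->
  a != 0 -> F.@[a 0] = 0 ->
  row_free B -> (B == tangent F a)%MS -> normal_surface (section F B) ->
  (a *m M) 0 'o_0 + (a *m M) 0 'o_1 + (a *m M) 0 'o_2 != 0.
Proof.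
move=> K_inf two_neq0 a_neq0 Fa B_free BT f_normal; apply/eqP => h0.
have [_ xG] := model_on_igusa Fa; have x0 := model_sum a 0.
have [b Fab] := tangent_hyperplane B_free BT; case: FM => _ _ c_neq0 _.
set x := (a *m M) 0 in h0 xG x0 *.
pose P := x 'o_0 ^+ 2 + x 'o_0 * x 'o_1 + x 'o_1 ^+ 2.
pose P' := x 'o_3 ^+ 2 + x 'o_3 * x 'o_4 + x 'o_4 ^+ 2.
pose C := x 'o_0 * x 'o_1 * x 'o_2 - x 'o_3 * x 'o_4 * x 'o_5.
have x2E : x 'o_2 = - (x 'o_0 + x 'o_1) by apply/eqP; rewrite -addr_eq0 addrC h0.
have x5E : x 'o_5 = - (x 'o_3 + x 'o_4).
  apply/eqP; rewrite -addr_eq0 addrC -[X in _ == X]x0 sum6 h0 add0r //.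
have PE : P = P'.
  apply/eqP; rewrite -subr_eq0 -sqrf_eq0; apply/eqP.
  apply: (mulfI two_neq0); apply: (mulfI two_neq0); rewrite !mulr0.
  rewrite -[RHS](subrr (4%:R * psum 4 x)) -{2}xG /psum !sum6 x2E x5E /P /P'; ring.
(* Once [P = P'], the tangent hyperplane at [a] is [x0 + x1 + x2 = 0] itself, so the tangent section
   is the double quadric. *)
have polarE d : polar F a d = - (16%:R * c * C) *
    ((d *m M) 0 'o_0 + (d *m M) 0 'o_1 + (d *m M) 0 'o_2).
  have d0 := model_sum d 0; rewrite model_polar -/x.
  have -> : psum 2 x = 2%:R * P + 2%:R * P'.
    by rewrite /psum !sum6 x2E x5E /P /P'; ring.
  move: d0; set w := (d *m M) 0; rewrite !sum6 => /eqP.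
  rewrite addrC addr_eq0 => /eqP ->.
  transitivity (c * (- (16%:R * C) * (w 'o_0 + w 'o_1 + w 'o_2)
    + 8%:R * (P' - P) * (x 'o_0 * w 'o_0 + x 'o_1 * w 'o_1 + x 'o_2 * w 'o_2)
    + 8%:R * (P - P') * (x 'o_3 * w 'o_3 + x 'o_4 * w 'o_4 -
       x 'o_5 * (w 'o_0 + w 'o_1 + w 'o_2 + w 'o_3 + w 'o_4)))).
    by rewrite /C /P /P' x2E x5E; ring.
  by rewrite PE subrr !mulr0 !mul0r !addr0; ring.
have C_neq0 : 16%:R * c * C != 0.
  by apply: contraNneq Fab => C0; rewrite polarE C0 oppr0 mul0r.
have B0 r : (B *m M) r 'o_0 + (B *m M) r 'o_1 + (B *m M) r 'o_2 = 0.
  have /eqP : polar F a (row r B) = 0.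
    by move: r; apply/sub_tangent; rewrite (eqmxP BT).
  rewrite polarE mulf_eq0 oppr_eq0 (negPf C_neq0) /= => /eqP.
  by rewrite -row_mul !mxE.
pose l i := section 'X_i (B *m M).
have l2E : l 'o_2 = - (l 'o_0 + l 'o_1).
  apply/eqP; rewrite -addr_eq0 addrC /l !sectionX -!big_split /= big1 // => r _.
  by rewrite -!scalerDl B0 scale0r.
have l5E : l 'o_5 = - (l 'o_3 + l 'o_4).
  apply/eqP; rewrite -addr_eq0 addrC /l !sectionX -!big_split /= big1 // => r _.
  by rewrite -!scalerDl; have := model_sum B r; rewrite sum6 B0 add0r => ->;
    rewrite scale0r.
pose Q := (l 'o_0 ^+ 2 + l 'o_0 * l 'o_1 + l 'o_1 ^+ 2)
  - (l 'o_3 ^+ 2 + l 'o_3 * l 'o_4 + l 'o_4 ^+ 2).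
have fE : section F B = (- (4%:R * c)) *: Q ^+ 2.
  transitivity (c *: ((\sum_i l i ^+ 2) ^+ 2 - 4%:R *: (\sum_i l i ^+ 4))).
    exact: igusa_section_coord.
  rewrite -mulNr mulrC -scalerA; congr (_ *: _); rewrite scaleNr !scaler_nat.
  rewrite !sum6 /Q l2E l5E.
  by move: (l 'o_0) (l 'o_1) (l 'o_3) (l 'o_4) => ? ? ? ?; ring.
have Q_homog : Q \is 2.-homog.
  have lm i j : l i * l j \is 2.-homog by apply: (dhomogM (d := 1) (e := 1));
    exact: section_linear.
  by rewrite /Q !expr2; apply: rpredB; rewrite !rpredD ?lm.
have [y ay] : exists y, a = y *m B.
  apply/submxP; rewrite (eqmxP BT); apply/sub_tangent => i.
  by rewrite ord1 row_id model_polar_self.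
have Bf : (section F B).@[y 0] = 0 by rewrite section_meval -ay.
apply: (double_section_not_normal (y := y) K_inf fE Q_homog _ _ f_normal).
  by apply: contraNneq a_neq0 => y0; rewrite ay y0 mul0mx.
apply/eqP; move: Bf; rewrite fE mevalZ mevalM => /eqP.
by rewrite mulf_eq0 oppr_eq0 !mulf_eq0 (negPf c_neq0) (natrM _ 2 2) mulf_eq0
  (negPf two_neq0) /= orbb.
Qed.



Lemma section_igusa_homog m (B : 'M_(m, 5)) : section F B \is 4.-homog.
Proof.
have lX n (r : seq 'I_6) : \sum_(i <- r) section 'X_i (B *m M) ^+ n \is n.-homog.
  by apply: rpred_sum => i _; have := dhomogMn n (section_linear (B *m M) i);
    rewrite mul1n.
rewrite igusa_section_coord; apply/rpredZ/rpredB; last exact/rpredZ/lX.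
exact: dhomogMn 2 (lX 2%N _).
Qed.

(* In characteristic 3 the quartic is a cone with vertex (1, .., 1), so its
   tangent sections are singular along the line through the vertex. *)
Lemma normal_char_neq3 (a : 'rV_5) (B : 'M_(4, 5)) :
  (forall p : {poly K}, p != 0 -> exists x, p.[x] != 0) ->
  a != 0 -> F.@[a 0] = 0 -> row_free B -> (B == tangent F a)%MS ->
  normal_surface (section F B) -> 3%:R != 0 :> K.
Proof.
move=> K_inf a_neq0 Fa B_free BT f_normal; apply/eqP => three0.
have [f_neq0 _] := f_normal; have [b Fab] := tangent_hyperplane B_free BT.
case: (FM) => M_free _ c_neq0 _; set f := section F B in f_neq0 f_normal.
pose W := B *m M; have f_homog : f \is 4.-homog by exact: section_igusa_homog.
have six0 : 6%:R = 0 :> K by rewrite (natrM _ 2 3) three0 mulr0.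
(* The vector (1, .., 1) has sum 6 = 0, so the vertex belongs to the hyperplane; [e] gives its
   coordinates there. *)
have [e eE] : exists e, const_mx 1 = e *m M :> 'rV_6.
  by apply: model_lift => i; rewrite -[RHS]six0 sum6 !mxE; ring.
have psum3 (x : 'I_6 -> K) : \sum_i x i = 0 -> psum 3 x = 0.
  rewrite /psum !sum6 => /eqP; rewrite addrC addr_eq0 => /eqP ->.
  rewrite -[RHS](mul0r (- ((x 'o_1 + x 'o_2) * (x 'o_0 + x 'o_2) * (x 'o_0 + x 'o_1) +
    (x 'o_0 + x 'o_1 + x 'o_2 + x 'o_3) * (x 'o_0 + x 'o_1 + x 'o_2 + x 'o_4) *
      (x 'o_3 + x 'o_4)))) -three0; ring.
have sub_B d : polar F a d = 0 -> exists y, d = y *m B.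
  by move=> ad; apply/submxP; rewrite (eqmxP BT); apply/sub_tangent => i;
    rewrite ord1 row_id.
have [al alE] := sub_B a (model_polar_self Fa).
have [ep epE] : exists ep, e = ep *m B.
  apply: sub_B; rewrite model_polar -eE; set x := (a *m M) 0.
  transitivity (c * (4%:R * psum 2 x * \sum_i x i - 16%:R * psum 3 x)).
    by rewrite /psum !sum6 !mxE; ring.
  by rewrite psum3 model_sum // !mulr0 subr0 mulr0.
have epW : ep *m W = const_mx 1 by rewrite mulmxA -epE eE.
have alW : al *m W = a *m M by rewrite mulmxA -alE.
have polarW (y : 'rV_4) : polar F a (y *m B) = 0.
  have /sub_tangent/(_ 0) : (y *m B <= tangent F a)%MS.
    by rewrite -(eqmxP BT) submxMl.
  by rewrite row_id.
have al_neq0 : al != 0 by apply: contraNneq a_neq0 => al0; rewrite alE al0 mul0mx.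
have [i ali] : exists i, al 0 i != 0.
  apply/existsP; apply: contraNT al_neq0; rewrite negb_exists => /forallP y0.
  by apply/eqP/rowP => i; rewrite mxE; apply/eqP; have := y0 i; rewrite negbK.
pose al1 : 'rV_4 := (al 0 i)^-1 *: al; pose x1 : 'I_6 -> K := (al1 *m W) 0.
have al1i : al1 0 i = 1 by rewrite mxE mulVf.
have x1E j : x1 j = (al 0 i)^-1 * (a *m M) 0 j.
  by rewrite /x1 -scalemxAl alW mxE.
have x10 : \sum_j x1 j = 0.
  by under eq_bigr => j _ do rewrite x1E; rewrite -mulr_sumr model_sum mulr0.
have x1G : (\sum_j x1 j ^+ 2) ^+ 2 - 4%:R * \sum_j x1 j ^+ 4 = 0.
  transitivity ((al 0 i)^-1 ^+ 4 *
      (psum 2 ((a *m M) 0) ^+ 2 - 4%:R * psum 4 ((a *m M) 0))).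
    by rewrite /psum !sum6 !x1E; ring.
  by have [_ ->] := model_on_igusa Fa; rewrite subrr mulr0.
have x1P (y : 'rV_4) : \sum_j (4%:R * (\sum_l x1 l ^+ 2) * x1 j - 16%:R * x1 j
  ^+ 3) * (y *m W) 0 j = 0.
  apply: (mulfI c_neq0); rewrite mulr0.
  transitivity ((al 0 i)^-1 ^+ 3 * polar F a (y *m B)); last by rewrite polarW mulr0.
  by rewrite model_polar -mulmxA -/W /psum !sum6 !x1E; ring.
have fW (y : 'rV_4) : f.@[y 0] =
    c * ((\sum_j (y *m W) 0 j ^+ 2) ^+ 2 - 4%:R * \sum_j (y *m W) 0 j ^+ 4).
  by rewrite section_meval model_eval /W mulmxA.
have ep_neq0 : ep != 0.
  apply: contraNneq (oner_neq0 K) => ep0; have /matrixP/(_ 0 'o_0) := epW.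
  by rewrite ep0 mul0mx !mxE => <-.
(* At the vertex the gradient would be a constant vector and the polar form would vanish
   identically. *)
have al1_ep : ~~ (al1 <= ep)%MS.
  apply: contra Fab => /sub_rVP[t al1E].
  have aM j : (a *m M) 0 j = al 0 i * t.
    apply: (mulfI (invr_neq0 ali)); rewrite -x1E /x1 al1E -scalemxAl epW !mxE.
    by rewrite mulrA mulVf // mul1r mulr1.
  rewrite model_polar (eq_bigr (fun j => (4%:R * psum 2 ((a *m M) 0) * (al 0 i * t)
    - 16%:R * (al 0 i * t) ^+ 3) * (b *m M) 0 j)) => [|j _]; last by rewrite aM.
  by rewrite -mulr_sumr model_sum !mulr0.
have U_free : row_free (col_mx ep al1).
  by apply: row_free_colr al1_ep; rewrite /row_free rank_rV ep_neq0.
have [w] : exists w : 'rV_4, (f * 'X_i).@[w 0] != 0.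
  apply: mpoly_eval_neq0 K_inf _ _ _.
  rewrite mulf_neq0 //; apply/eqP => /(congr1 (meval (al1 0))).
  by rewrite mevalXU meval0 al1i => /eqP; rewrite oner_eq0.
rewrite mevalM mevalXU mulf_eq0 negb_or => /andP[fw wi].
pose z := (w 0 i)^-1 *: w - al1.
have zi : z 0 i = 0 by rewrite mxE [X in X + _]mxE [X in _ + X]mxE al1i mulVf
  // subrr.
(* [f] vanishes on the span of the vertex and [al1], but not at [w]. *)
have zU : ~~ (z <= col_mx ep al1)%MS.
  apply: contra fw => zU; have : (w <= col_mx ep al1)%MS.
    rewrite -(eqmx_scale _ (invr_neq0 wi)) -[X in (X <= _)%MS](subrK al1).
    by rewrite addmx_sub // -addsmxE addsmxSr.
  rewrite -addsmxE => /sub_addsmxP[[u v] /= wE].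
  have wW j : (w *m W) 0 j = u 0 0 + v 0 0 * x1 j.
    rewrite wE mulmxDl -!mulmxA epW mxE [(u *m _) 0 j]mxE big_ord1 [const_mx _
      _ _]mxE mulr1.
    by rewrite mxE big_ord1.
  rewrite fW; under eq_bigr => j _ do rewrite wW.
  under [X in _ * (_ - _ * X)]eq_bigr => j _ do rewrite wW.
  rewrite (igusa_shift_char3 (u 0 0) (y := fun j => v 0 0 * x1 j)) //; last first.
    by rewrite -mulr_sumr x10 mulr0.
  apply/eqP; transitivity (c * v 0 0 ^+ 4 *
    ((\sum_j x1 j ^+ 2) ^+ 2 - 4%:R * \sum_j x1 j ^+ 4)); last by rewrite x1G mulr0.
  by rewrite !sum6; ring.
have V_free := row_free_colr U_free zU.
have /row_subPn[j] : ~~ (1%:M <= col_mx (col_mx ep al1) z)%MS.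
  by apply/negP => /mxrankS; rewrite mxrank1 (eqP V_free).
set r := row j _ => rV; pose z' := r - r 0 i *: al1.
have z'i : z' 0 i = 0 by rewrite mxE [X in _ + X]mxE [X in _ - X]mxE al1i mulr1 subrr.
have z'V : ~~ (z' <= col_mx (col_mx ep al1) z)%MS.
  apply: contra rV => z'V; rewrite -[r](subrK (r 0 i *: al1)) addmx_sub //.
  by apply: scalemx_sub; rewrite -addsmxE; apply: submx_trans (addsmxSl _ _);
    rewrite -addsmxE addsmxSr.
(* Coordinates adapted to the line through the vertex and [al1]: in them [f] lies in the square of
   the ideal of the last two. The directions [z] and [z'] stay in the chart. *)
pose D : 'M_4 := col_mx (col_mx (col_mx ep al1) z) z'.
have D_unit : D \in unitmx by rewrite -row_free_unit;
  exact: (row_free_colr V_free z'V).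
pose I0 : 'I_4 := @Ordinal 4 0 isT; pose I1 : 'I_4 := @Ordinal 4 1 isT.
pose I2 : 'I_4 := @Ordinal 4 2 isT; pose I3 : 'I_4 := @Ordinal 4 3 isT.
have D0 : row I0 D = ep.
  have -> : I0 = lshift 1 (lshift 1 (lshift 1 (0 : 'I_1))) by exact: val_inj.
  by apply/rowP => l; rewrite [LHS]mxE; apply: etrans (col_mxEu _ _ _ _) _;
    rewrite !col_mxEu.
have D1 : row I1 D = al1.
  have -> : I1 = lshift 1 (lshift 1 (rshift 1 (0 : 'I_1))) by exact: val_inj.
  by apply/rowP => l; rewrite [LHS]mxE; apply: etrans (col_mxEu _ _ _ _) _;
    rewrite col_mxEu col_mxEd.
have D2 : row I2 D = z.
  have -> : I2 = lshift 1 (rshift 2 (0 : 'I_1)) by exact: val_inj.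
  by apply/rowP => l; rewrite [LHS]mxE; apply: etrans (col_mxEu _ _ _ _) _;
    rewrite col_mxEd.
have D3 : row I3 D = z'.
  have -> : I3 = rshift 3 (0 : 'I_1) by exact: val_inj.
  by apply/rowP => l; rewrite [LHS]mxE; apply: etrans (col_mxEd _ _ _ _) _.
have sD : ideal_sq ('X_I2 : {mpoly K[4]}) 'X_I3 (section f D).
  have coordD l : section 'X_l (D *m B *m M) =
      'X_I0 + ('X_I1 * (x1 l)%:MP + ('X_I2 * ((z *m W) 0 l)%:MP + 'X_I3 * ((z'
        *m W) 0 l)%:MP)).
    rewrite sectionX !big_ord_recl big_ord0 addr0 -mulmxA -/W.
    have DW m (u : 'rV_4) : row m D = u -> (D *m W) m l = (u *m W) 0 l.
      by move=> <-; rewrite -row_mul [RHS]mxE.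
    have [o1 o2 o3] : [/\ lift ord0 ord0 = I1, lift ord0 (lift ord0 ord0) = I2 &
        lift ord0 (lift ord0 (lift ord0 ord0)) = I3] by split; exact: val_inj.
    rewrite o3 o2 o1 (_ : ord0 = I0); last exact: val_inj.
    rewrite (DW _ _ D0) (DW _ _ D1) (DW _ _ D2) (DW _ _ D3) epW mxE scale1r.
    by rewrite -!mul_mpolyC !(mulrC _%:MP).
  rewrite section_section igusa_section_coord -mul_mpolyC; apply: ideal_sqM.
  under eq_bigr => l _ do rewrite coordD.
  under [X in _ - _ *: X]eq_bigr => l _ do rewrite coordD.
  (* The coordinate along the vertex drops out as a translation, and the Taylor expansion at [x1]
     remains. *)
  rewrite scaler_nat -mulr_natl igusa_shift_char3; last 2 first.
  - by rewrite -(mpolyC_nat _ _ 3) three0 mpolyC0.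
  - rewrite !big_split /= -!mulr_sumr -!rmorph_sum /= x10 /W !mulmxA !model_sum.
    by rewrite !mpolyC0 !mulr0 !addr0.
  exact: (@igusa_tangent_ideal_map _ (@mpolyC 4 K) 'X_I1 'X_I2 'X_I3 x1
    ((z *m W) 0) ((z' *m W) 0)).
have [P [C [Q fDE]]] := sD.
have rowD l m : (row l D *m invmx D) 0 m = (l == m)%:R.
  by rewrite -row_mul mulmxV // !mxE.
have fS : f = section (section f D) (invmx D).
  by rewrite section_section mulVmx // section1.
apply: (singular_line_not_normal (i := i) (y := al1) (z := z) (z' := z')
  (B := section P (invmx D)) (C := section C (invmx D)) (D := section Q (invmx D))
  (N := section 'X_I2 (invmx D)) (L := section 'X_I3 (invmx D)) _ _ _ _ _ _ _ _
    _ f_normal) => //.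
- by rewrite {1}fS fDE !sectionD !sectionM.
- by rewrite on_line_section -D1 -D2 !rowD scale0r addr0.
- by rewrite on_line_section -D1 -D2 !rowD scale1r add0r.
- by rewrite on_line_section -D1 -D3 !rowD scale1r add0r.
- by rewrite on_line_section -D1 -D3 !rowD scale0r addr0.
- apply/eqP => /(congr1 (fun p => p.[1])); rewrite on_line_horner horner0 scale1r.
  rewrite addrC subrK (meval_homog _ _ f_homog) => /eqP.
  by rewrite mulf_eq0 expf_eq0 invr_eq0 (negPf wi) andbF (negPf fw).
Qed.

End Points.



End Model.

(** * The plane spanned by a trope *)

Lemma not_in_E_normal (K : fieldType) (F : {mpoly K[5]}) (a : 'rV_5) :
  F.@[a 0] = 0 -> ~ in_E F a -> exists B : 'M_(4, 5),
    [/\ row_free B, (B == tangent F a)%MS & normal_surface (section F B)].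
Proof. by move=> Fa aE; apply: NNPP => aB; apply: aE. Qed.

Lemma injection3 (i j l : 'I_6) : uniq [:: i; j; l] ->
  exists2 f : 'I_6 -> 'I_6, injective f & [/\ f 'o_0 = i, f 'o_1 = j & f 'o_2 = l].
Proof.
rewrite /= !inE negb_or andbT => /andP[/andP[ij il] jl].
pose s0 := tperm 'o_0 i; pose j1 := s0 j; pose s1 := tperm 'o_1 j1.
pose l2 := s1 (s0 l); pose s2 := tperm 'o_2 l2.
have j1_neq0 : j1 != 'o_0.
  by rewrite -(inj_eq (@perm_inj _ s0)) tpermK tpermL eq_sym.
have s1_0 : s1 'o_0 = 'o_0 by rewrite tpermD.
have l2_neq0 : l2 != 'o_0.
  rewrite -(inj_eq (@perm_inj _ s1)) tpermK s1_0.
  by rewrite -(inj_eq (@perm_inj _ s0)) tpermK tpermL eq_sym.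
have l2_neq1 : l2 != 'o_1.
  rewrite -(inj_eq (@perm_inj _ s1)) tpermK tpermL.
  by rewrite -(inj_eq (@perm_inj _ s0)) !tpermK eq_sym.
exists (fun z => s0 (s1 (s2 z))); first by move=> u v /perm_inj/perm_inj/perm_inj.
split; first by rewrite [s2 _]tpermD // s1_0 tpermL.
  by rewrite [s2 _]tpermD // tpermL tpermK.
by rewrite tpermL !tpermK.
Qed.

Section Trope.
Variable K : fieldType.
Hypotheses (two_neq0 : 2%:R != 0 :> K) (three_neq0 : 3%:R != 0 :> K).
Variables (F : {mpoly K[5]}) (M : 'M[K]_(5, 6)) (c : K).
Hypothesis FM : igusa_model F M c.

Lemma model_polar_eq0 (a b : 'rV_5) :
  (polar F a b == 0) = (\sum_i gauss ((a *m M) 0) i * (b *m M) 0 i == 0).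
Proof.
have [_ _ c_neq0 _] := FM.
rewrite -(mulrI_eq0 _ (mulfI three_neq0)) (model_polar_gauss FM).
by rewrite mulf_eq0 oppr_eq0 !mulf_eq0 (negPf c_neq0) (natrM _ 2 2) mulf_eq0
  (negPf two_neq0).
Qed.

Variables p q : K.
Hypothesis pq_neq0 : p * q * (p - 1) * (q - 1) * (p * q - 1) != 0.

Definition trope_mx : 'M[K]_(3, 6) :=
  \matrix_(j, i) trope_coord p q (j == 0)%:R (j == 1)%:R (j == 2%:R)%:R i.

Definition veronese al be : 'rV[K]_3 :=
  \row_j [:: al ^+ 2; al * be; be ^+ 2]`_j.

Lemma mul_trope_mx (n : 'rV_3) i :
  (n *m trope_mx) 0 i = trope_coord p q (n 0 0) (n 0 1) (n 0 2%:R) i.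
Proof.
rewrite mxE !big_ord_recl big_ord0 addr0 !mxE.
have [-> ->] : lift ord0 ord0 = 1 :> 'I_3 /\ lift ord0 (lift ord0 ord0) = 2%:R
  :> 'I_3.
  by split; apply: val_inj.
by elim/ord6P: i; rewrite /trope_coord /=; ring.
Qed.

Lemma section_trope_mx : section (igusa_form K) trope_mx =
  - (18%:R * (p * q * (p - 1) * (q - 1) * (p * q - 1))) ^+ 2
  *: (('X_1 ^+ 2 - 'X_0 * 'X_2%:R) ^+ 2).
Proof.
have coord (R : comNzRingType) (phi : {rmorphism K -> R}) (x0 x1 x2 : R) i :
    phi (trope_mx 0 i) * x0 + phi (trope_mx 1 i) * x1 + phi (trope_mx 2%:R i) * x2 =
    trope_coord (phi p) (phi q) x0 x1 x2 i.
  by rewrite !mxE /=; elim/ord6P: i; rewrite /trope_coord /=; ring.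
have coordX i : \sum_(j < 3) trope_mx j i *: 'X_j =
    trope_coord p%:MP q%:MP 'X_0 'X_1 'X_2%:R i :> {mpoly K[3]}.
  rewrite -(coord _ (@mpolyC 3 K)) !big_ord_recl big_ord0 addr0 addrA.
  have [-> ->] : lift ord0 ord0 = 1 :> 'I_3 /\ lift ord0 (lift ord0 ord0) =
    2%:R :> 'I_3.
    by split; apply: val_inj.
  by rewrite !mul_mpolyC.
rewrite section_igusa [4%:R *: _]scaler_nat -[_ *+ 4]mulr_natl.
under eq_bigr => i _ do rewrite coordX.
under [X in _ - 4%:R * X]eq_bigr => i _ do rewrite coordX.
rewrite igusa_trope_coord -mul_mpolyC; congr (_ * _).
have phiE (R : comNzRingType) (phi : {rmorphism K -> R}) :
  - (18%:R * (phi p * phi q * (phi p - 1) * (phi q - 1) * (phi p * phi q - 1))) ^+ 2 =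
  phi (- (18%:R * (p * q * (p - 1) * (q - 1) * (p * q - 1))) ^+ 2) by ring.
exact: (phiE _ (@mpolyC 3 K)).
Qed.

(** Translation by a kernel vector leaves the restricted quartic unchanged, hence also the square of
    [disc]. As the conic is smooth, only the zero vector does this; no minor is computed. *)
Lemma trope_mx_inj m (V : 'M_(m, 3)) : V *m trope_mx = 0 -> V = 0.
Proof.
have k_neq0 : - (18%:R * (p * q * (p - 1) * (q - 1) * (p * q - 1))) ^+ 2 != 0.
  rewrite oppr_eq0 expf_neq0 // mulf_neq0 // (natrM _ 2 9) (natrM _ 3 3).
  by rewrite !mulf_neq0.
pose disc (n : 'rV[K]_3) := n 0 1 ^+ 2 - n 0 0 * n 0 2%:R.
have discE n : - (18%:R * (p * q * (p - 1) * (q - 1) * (p * q - 1))) ^+ 2 *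
  disc n ^+ 2 =
    (\sum_i (n *m trope_mx) 0 i ^+ 2) ^+ 2 - 4%:R * \sum_i (n *m trope_mx) 0 i ^+ 4.
  rewrite -igusa_trope_coord; congr (_ ^+ 2 - _ * _); apply: eq_bigr => i _.
    by rewrite mul_trope_mx.
  by rewrite mul_trope_mx.
have kernel_disc n t : n *m trope_mx = 0 -> disc (n + t) ^+ 2 = disc t ^+ 2.
  by move=> n0; apply: (mulfI k_neq0); rewrite !discE mulmxDl n0 add0r.
suff row_inj (n : 'rV_3) : n *m trope_mx = 0 -> n = 0.
  by move=> V0; apply/row_matrixP => i; rewrite row0; apply: row_inj;
    rewrite -row_mul V0 row0.
move=> n0; have nN0 : - n *m trope_mx = 0 by rewrite mulNmx n0 oppr0.
have disc_n : n 0 1 ^+ 2 = n 0 0 * n 0 2%:R.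
  apply/eqP; rewrite -subr_eq0 -sqrf_eq0 -/(disc n) -[n in disc n]addr0
    (kernel_disc _ _ n0).
  by rewrite /disc !mxE; apply/eqP; ring.
pose t (u v w : K) : 'rV_3 := \row_j [:: u; v; w]`_j.
have dE u v w (s : 'rV_3) : disc (s + t u v w) =
    (s 0 1 + v) ^+ 2 - (s 0 0 + u) * (s 0 2%:R + w) by rewrite /disc !mxE.
have tE u v w : disc (t u v w) = v ^+ 2 - u * w by rewrite /disc !mxE.
(* The left side of the conclusion is the polar form S of [disc] at [n] and [t u v w]. Translating
   by [n] and by [- n] adds S to [disc] and subtracts it; the difference of the two squares is 4 S
   [disc]. *)
have expand u v w : (v ^+ 2 - u * w) ^+ 2 = 1 ->
    2%:R * n 0 1 * v - n 0 0 * w - n 0 2%:R * u = 0.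
  move=> uvw.
  have E : (2%:R * n 0 1 * v - n 0 0 * w - n 0 2%:R * u + (v ^+ 2 - u * w)) ^+ 2 = 1.
    transitivity (disc (n + t u v w) ^+ 2); last by rewrite (kernel_disc _ _ n0) tE.
    rewrite dE; congr (_ ^+ 2).
    apply/esym/subr0_eq; transitivity (n 0 1 ^+ 2 - n 0 0 * n 0 2%:R); first by ring.
    by rewrite disc_n subrr.
  have E' : (v ^+ 2 - u * w - (2%:R * n 0 1 * v - n 0 0 * w - n 0 2%:R * u)) ^+ 2 = 1.
    transitivity (disc (- n + t u v w) ^+ 2);
      last by rewrite (kernel_disc _ _ nN0) tE.
    rewrite dE ![(- n) _ _]mxE; congr (_ ^+ 2).
    apply/esym/subr0_eq; transitivity (n 0 1 ^+ 2 - n 0 0 * n 0 2%:R); first by ring.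
    by rewrite disc_n subrr.
  have D_neq0 : v ^+ 2 - u * w != 0.
    by apply/eqP => D0; move: uvw; rewrite D0 expr0n => /eqP; rewrite eq_sym oner_eq0.
  apply: (mulfI D_neq0); apply: (mulfI two_neq0); apply: (mulfI two_neq0);
    rewrite !mulr0.
  set S := _ - n 0 2%:R * u in E E' *.
  transitivity ((S + (v ^+ 2 - u * w)) ^+ 2 - (v ^+ 2 - u * w - S) ^+ 2);
    first by ring.
  by rewrite E E' subrr.
have n1 : n 0 1 = 0.
  apply: (mulfI two_neq0); rewrite mulr0.
  by transitivity (2%:R * n 0 1 * 1 - n 0 0 * 0 - n 0 2%:R * 0);
    [ring|apply: expand; ring].
have n02 : n 0 0 + n 0 2%:R = 0.
  apply: oppr_inj; rewrite oppr0.
  transitivity (2%:R * n 0 1 * 0 - n 0 0 * 1 - n 0 2%:R * 1); first by ring.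
  by apply: expand; ring.
have n20 : n 0 0 - n 0 2%:R = 0.
  transitivity (2%:R * n 0 1 * 0 - n 0 0 * (-1) - n 0 2%:R * 1); first by ring.
  by apply: expand; ring.
have n00 : n 0 0 = 0.
  apply: (mulfI two_neq0); rewrite mulr0.
  by transitivity (n 0 0 + n 0 2%:R + (n 0 0 - n 0 2%:R));
    [ring|rewrite n02 n20 addr0].
have n22 : n 0 2%:R = 0 by rewrite -n02 n00 add0r.
apply/rowP => j; rewrite [RHS]mxE.
by case: j => [[|[|[|//]]] ltj];
  [rewrite -[RHS]n00|rewrite -[RHS]n1|rewrite -[RHS]n22]; congr (n 0 _);
  apply: val_inj.
Qed.

Definition node_form al be : K :=
  al * be * (((p - 1) * al + (q - 1) * be) * (be - p * al) * (al - q * be)).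

Lemma gauss_veronese (x : 'I_6 -> K) al be l i :
  (forall j, x j = (l *: (veronese al be *m trope_mx)) 0 j) ->
  gauss x i = - 162%:R * l ^+ 3 * (p * q * (p - 1) * (q - 1)) * node_form al be
    * segre_coord p q al be i.
Proof.
move=> xE; have {}xE j : x j = l * trope_coord p q (al ^+ 2) (al * be) (be ^+ 2) j.
  by rewrite xE mxE mul_trope_mx !mxE.
transitivity (l ^+ 3 * gauss (trope_coord p q (al ^+ 2) (al * be) (be ^+ 2)) i).
  by rewrite /gauss /psum !sum6 !xE; ring.
by rewrite gauss_trope_coord /node_form; ring.
Qed.

Lemma trope_param_veronese (a : 'rV_5) : trope_param p q ((a *m M) 0) ->
  exists al be l, l != 0 /\ a *m M = l *: (veronese al be *m trope_mx).
Proof.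
move=> [al [be [l [l_neq0 aE]]]]; exists al, be, l; split=> //.
by apply/rowP => i; rewrite aE [RHS]mxE mul_trope_mx !mxE.
Qed.

Lemma segre_trope_mx al be (n : 'rV_3) :
  \sum_i segre_coord p q al be i * (n *m trope_mx) 0 i = 0.
Proof.
by under eq_bigr => i _ do rewrite mul_trope_mx; exact: segre_trope_coord.
Qed.

(** The witness [b] shows that the gradient at [a] is nonzero, so the quintic factor cancels and the
    tangent hyperplane is dual to a point of the line. *)
Lemma tangent_veronese (a b d : 'rV_5) al be l :
  a *m M = l *: (veronese al be *m trope_mx) -> polar F a b != 0 ->
  (polar F a d == 0) = (\sum_i segre_coord p q al be i * (d *m M) 0 i == 0).
Proof.
move=> aE; rewrite !model_polar_eq0.
set r := - 162%:R * l ^+ 3 * (p * q * (p - 1) * (q - 1)) * node_form al be.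
have gE (y : 'rV_5) : \sum_i gauss ((a *m M) 0) i * (y *m M) 0 i =
    r * \sum_i segre_coord p q al be i * (y *m M) 0 i.
  rewrite mulr_sumr; apply: eq_bigr => i _.
  rewrite (gauss_veronese (al := al) (be := be) (l := l)) => [|j]; last by rewrite aE.
  by rewrite -/r mulrA.
by rewrite !gE !mulf_eq0 negb_or => /andP[/negPf->].
Qed.

(** Up to sign, the square of [al * be' - al' * be] is the polar form of the conic at two of its
    points, which vanishes when they are proportional. *)
Lemma veronese_cross al be al' be' (t : K) :
  veronese al be = t *: veronese al' be' -> al * be' = al' * be.
Proof.
move=> E; have Ej j : veronese al be 0 j = t * veronese al' be' 0 j by rewrite E mxE.
have := Ej 0; have := Ej 1; have := Ej 2%:R; rewrite !mxE /= => E2 E1 E0.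
apply: subr0_eq; apply/eqP; rewrite -sqrf_eq0; apply/eqP.
transitivity (al ^+ 2 * be' ^+ 2 - 2%:R * (al * be) * (al' * be') + al' ^+ 2 *
  be ^+ 2); first by ring.
by rewrite E0 E1 E2; ring.
Qed.

Lemma veronese_proportional al be al' be' : veronese al' be' != 0 ->
  al * be' = al' * be -> exists t, veronese al be = t *: veronese al' be'.
Proof.
have [->|al'_neq0] := eqVneq al' 0.
  have [->|be'_neq0] := eqVneq be' 0.
    move=> /eqP[]; apply/rowP => j; rewrite !mxE.
    by case: j => [[|[|[|//]]] ltj]; rewrite /= ?mulr0 ?expr0n.
  move=> _ /eqP; rewrite mul0r mulf_eq0 (negPf be'_neq0) orbF => /eqP ->.
  exists ((be / be') ^+ 2); apply/rowP => j; rewrite !mxE.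
  by case: j => [[|[|[|//]]] ltj];
    rewrite /= ?mulr0 ?mul0r ?expr0n ?mulr0 // -exprMn divfK.
move=> _ E; exists ((al / al') ^+ 2); have -> : be = al / al' * be'.
  by apply: (mulfI al'_neq0); rewrite -E mulrA [al' * _]mulrC divfK.
apply/rowP => j; rewrite !mxE.
by case: j => [[|[|[|//]]] ltj] /=; field.
Qed.

(** The plane is orthogonal to the whole line, so it lies in both tangent hyperplanes. Equality is a
    matter of dimension as soon as the two hyperplanes differ, and a vector [d] in only one of them
    shows it. *)
Lemma common_tangent_rank (a b : 'rV_5) al be l al' be' l' :
  \rank (tangent F a) = 4%N ->
  a *m M = l *: (veronese al be *m trope_mx) ->
  b *m M = l' *: (veronese al' be' *m trope_mx) ->
  (exists d, polar F a d != 0) -> (exists d, polar F b d != 0) ->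
  al * be' != al' * be ->
  exists T : 'M_(3, 5), T *m M = trope_mx /\
    (tangent F a :&: tangent F b == T)%MS.
Proof.
move=> rTa aE bE [da ad] [db bd] cross.
have [|T TE] := model_lift FM (V := trope_mx).
  move=> j; rewrite -[RHS](trope_coord_sum p q (j == 0)%:R (j == 1)%:R (j ==
    2%:R)%:R).
  by apply: eq_bigr => i _; rewrite mxE.
exists T; split=> //.
have T_free : row_free T.
  rewrite -kermx_eq0; apply/eqP/trope_mx_inj.
  by rewrite TE mulmxA mulmx_ker mul0mx.
have subT x y be0 al0 l0 : x *m M = l0 *: (veronese al0 be0 *m trope_mx) ->
    polar F x y != 0 -> (T <= tangent F x)%MS.
  move=> xE xy; apply/sub_tangent => i; apply/eqP; rewrite (tangent_veronese _ xE xy).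
  by rewrite -row_mul -TE -[trope_mx]mul1mx row_mul segre_trope_mx.
have sub : (T <= tangent F a :&: tangent F b)%MS.
  by rewrite sub_capmx (subT _ _ _ _ _ aE ad) (subT _ _ _ _ _ bE bd).
rewrite andbC sub /= -(geq_leqif (mxrank_leqif_sup sub)) (eqP T_free).
suff : (\rank (tangent F a :&: tangent F b) < \rank (tangent F a))%N by rewrite rTa.
rewrite ltn_neqAle mxrankS ?capmxSl // andbT.
apply/negP; rewrite (mxrank_leqif_eq (capmxSl _ _)) sub_capmx submx_refl /=.
move=> /andP[_ Tab].
(* The coordinates of w are chosen so that its pairing with the Segre points is
   the determinant of their parameters. *)
pose w : 'rV[K]_6 := \row_i [:: - (q * be) - 2%:R * (p * al);
  2%:R * (q * be) + p * al; 2%:R * (q * be) - 2%:R * (p * al);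
  p * al - q * be; p * al - q * be; p * al - q * be]`_i.
have wE al0 be0 : \sum_i segre_coord p q al0 be0 i * w 0 i =
    2%:R * 3%:R * (p * q) * (1 - p * q) * (al0 * be - al * be0).
  by rewrite sum6 !mxE /segre_coord /=; ring.
have [|d dE] := model_lift FM (V := w).
  by move=> i; rewrite ord1 sum6 !mxE /=; ring.
have : (d <= tangent F b)%MS.
  apply: submx_trans Tab; apply/sub_tangent => i; rewrite ord1 row_id.
  by apply/eqP; rewrite (tangent_veronese _ aE ad) -dE wE subrr mulr0.
move=> /sub_tangent/(_ 0)/eqP; rewrite row_id (tangent_veronese _ bE bd) -dE wE.
move: pq_neq0; rewrite !mulf_eq0 !negb_or => /andP[/andP[/andP[/andP[p0 q0] _]
  _] pq1].
rewrite (negPf two_neq0) (negPf three_neq0) (negPf p0) (negPf q0) /=.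
by rewrite -opprB oppr_eq0 (negPf pq1) subr_eq0 eq_sym (negPf cross).
Qed.

End Trope.

(** * The conic and its nodes *)

(** The shape of a smooth conic through the first two points of a basis: the squares of ['X_0] and
    ['X_1] are missing, and normalizing the coefficient of ['X_0 * 'X_1] removes the scalar
    ambiguity that would obstruct descent. *)
Definition conic_form (R : comNzRingType) (u v w : R) : {mpoly R[3]} :=
  'X_0 * 'X_1 + u *: ('X_0 * 'X_2%:R) + v *: ('X_1 * 'X_2%:R) + w *: ('X_2%:R *
    'X_2%:R).

Lemma conic_form_homog (R : comNzRingType) (u v w : R) :
  conic_form u v w \is 2.-homog.
Proof.
have XX i j : 'X_i * 'X_j \is [in R[3], 2.-homog].
  by apply: (dhomogM (d := 1) (e := 1)); rewrite dhomogX /= mdeg1.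
by rewrite /conic_form !rpredD ?rpredZ ?XX.
Qed.

Lemma map_conic_form (k K : fieldType) (iota : {rmorphism k -> K}) u v w :
  map_mpoly iota (conic_form u v w) = conic_form (iota u) (iota v) (iota w).
Proof. by rewrite /conic_form !rmorphD /= !map_mpolyZ !rmorphM /= !map_mpolyX. Qed.

Lemma conic_form_eval (K : fieldType) (u v w : K) (y : 'rV_3) :
  (conic_form u v w).@[y 0] = y 0 0 * y 0 1 + u * (y 0 0 * y 0 2%:R)
    + v * (y 0 1 * y 0 2%:R) + w * (y 0 2%:R * y 0 2%:R).
Proof. by rewrite /conic_form !mevalD !mevalZ !mevalM !mevalXU. Qed.

(** At (1, s, 0) the conic takes the value s. The value of [f] at s = 1 is [C]; its derivative in
    the third variable at s = 1 and s = -1 gives [u + v] and [u - v], and the second derivative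
    gives [w]. *)
Lemma square_descent (k K : fieldType) (iota : {rmorphism k -> K})
    (f : {mpoly k[3]}) (C u v w : K) : 2%:R != 0 :> k -> C != 0 ->
  map_mpoly iota f = C *: conic_form u v w ^+ 2 ->
  exists C0 u0 v0 w0, [/\ iota C0 = C, iota u0 = u, iota v0 = v, iota w0 = w &
    f = C0 *: conic_form u0 v0 w0 ^+ 2].
Proof.
move=> two_neq0 C_neq0 fE.
have two_neq0' : 2%:R != 0 :> K by rewrite -(rmorph_nat iota) fmorph_eq0.
suff [C0 [u0 [v0 [w0 [C0E u0E v0E w0E]]]]] :
    exists C0 u0 v0 w0, [/\ iota C0 = C, iota u0 = u, iota v0 = v & iota w0 = w].
  exists C0, u0, v0, w0; split=> //; apply: (map_mpoly_inj (iota := iota)).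
  by rewrite fE map_mpolyZ rmorphXn /= map_conic_form C0E u0E v0E w0E.
pose Q := conic_form u v w;
  pose dQ : {mpoly K[3]} := u *: 'X_0 + v *: 'X_1 + (2%:R * w) *: 'X_2%:R.
have QD : Q^`M(2%:R) = dQ.
  rewrite /Q /conic_form !mderivD !mderivZ !mderivM !mderivXU /=.
  by rewrite /dQ -!mul_mpolyC; ring.
have dQD : dQ^`M(2%:R) = (2%:R * w)%:MP.
  rewrite /dQ !mderivD !mderivZ !mderivXU /= !scaler0 !add0r.
  by rewrite -mul_mpolyC mulr1.
pose pt (s : k) : 'rV[k]_3 := \row_j [:: 1; s; 0]`_j.
have ev g s : iota (g.@[(pt s) 0]) = (map_mpoly iota g).@[(map_mx iota (pt s)) 0].
  by rewrite map_meval.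
have Qs s : Q.@[(map_mx iota (pt s)) 0] = iota s.
  by rewrite conic_form_eval !mxE /= rmorph0 rmorph1; ring.
have dQs s : dQ.@[(map_mx iota (pt s)) 0] = u + v * iota s.
  by rewrite !mevalD !mevalZ !mevalXU !mxE /= rmorph0 rmorph1; ring.
have f0 : iota (f.@[(pt 1) 0]) = C.
  by rewrite ev fE mevalZ mevalM Qs rmorph1 !mulr1.
have f1 s : iota (f^`M(2%:R).@[(pt s) 0]) = 2%:R * C * iota s * (u + v * iota s).
  by rewrite ev map_mderiv fE mderivZ mderivM QD mevalZ mevalD !mevalM Qs dQs; ring.
have f2 : iota (f^`M(2%:R)^`M(2%:R).@[(pt 1) 0]) = 2%:R * C * ((u + v) ^+ 2 +
  2%:R * w).
  rewrite ev !map_mderiv fE !mderivZ !mderivM mderivD !mderivM QD dQD.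
  by rewrite mevalZ !mevalD !mevalM mevalC Qs dQs rmorph1; ring.
have f0_neq0 : f.@[(pt 1) 0] != 0 by rewrite -(fmorph_eq0 iota) f0.
pose s0 := f^`M(2%:R).@[(pt 1) 0] / (2%:R * f.@[(pt 1) 0]).
pose t0 := - f^`M(2%:R).@[(pt (-1)) 0] / (2%:R * f.@[(pt 1) 0]).
pose r0 := f^`M(2%:R)^`M(2%:R).@[(pt 1) 0] / (2%:R * f.@[(pt 1) 0]).
have s0E : iota s0 = u + v.
  by rewrite /s0 fmorph_div rmorphM rmorph_nat f0 f1 rmorph1; field;
    rewrite two_neq0' C_neq0.
have t0E : iota t0 = u - v.
  by rewrite /t0 fmorph_div rmorphN rmorphM rmorph_nat f0 f1 rmorphN rmorph1;
    field; rewrite two_neq0' C_neq0.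
have r0E : iota r0 = (u + v) ^+ 2 + 2%:R * w.
  by rewrite /r0 fmorph_div rmorphM rmorph_nat f0 f2; field; rewrite two_neq0' C_neq0.
exists f.@[(pt 1) 0], ((s0 + t0) / 2%:R), ((s0 - t0) / 2%:R), ((r0 - s0 ^+ 2) / 2%:R).
split=> //; rewrite fmorph_div rmorph_nat.
- by rewrite rmorphD s0E t0E; field.
- by rewrite rmorphB s0E t0E; field.
- by rewrite rmorphB rmorphXn r0E s0E; field.
Qed.

Section Disc.
Variable K : fieldType.
Hypothesis two_neq0 : 2%:R != 0 :> K.

Definition disc_form : {mpoly K[3]} := 'X_1 ^+ 2 - 'X_0 * 'X_2%:R.

Lemma disc_form_eval (y : 'rV_3) :
  disc_form.@[y 0] = y 0 1 ^+ 2 - y 0 0 * y 0 2%:R.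
Proof. by rewrite mevalB !mevalM !mevalXU. Qed.

Lemma disc_form_veronese al be : disc_form.@[(veronese al be : 'rV[K]_3) 0] = 0.
Proof. by rewrite disc_form_eval !mxE /=; ring. Qed.

Lemma disc_form_smooth (y : 'rV_3) :
  (forall i, disc_form^`M(i).@[y 0] = 0) -> y = 0.
Proof.
move=> dy; have := dy 0; have := dy 1; have := dy 2%:R.
rewrite /disc_form !mderivB !mderivM !mderivXU /=.
rewrite !mevalB !mevalD !mevalM !mevalXU !(meval0, meval1).
rewrite !(mul0r, mulr0, mul1r, mulr1, addr0, add0r, sub0r, subr0, oppr0).
move=> /eqP; rewrite oppr_eq0 => /eqP y0.
move=> /eqP; rewrite -mulr2n -[_ *+ 2]mulr_natl mulf_eq0 (negPf two_neq0) => /eqP y1.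
move=> /eqP; rewrite oppr_eq0 => /eqP y2.
apply/rowP => j; rewrite [RHS]mxE.
by case: j => [[|[|[|//]]] ltj];
  [rewrite -[RHS]y0|rewrite -[RHS]y1|rewrite -[RHS]y2]; congr (y 0 _); apply: val_inj.
Qed.

(** The first two rows lie on the conic, which removes two squares. The coefficient [t] of
    ['X_0 * 'X_1] is the polar form at these rows, nonzero by the determinant condition. *)
Lemma section_disc_form (D : 'M_3) al be l al' be' l' :
  row 0 D = l *: veronese al be -> row 1 D = l' *: veronese al' be' ->
  l != 0 -> l' != 0 -> al * be' != al' * be ->
  exists t u v w, t != 0 /\ section disc_form D = t *: conic_form u v w.
Proof.
move=> /rowP D0 /rowP D1 l_neq0 l'_neq0 cross.
pose t := - (l * l' * (al * be' - al' * be) ^+ 2).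
have t_neq0 : t != 0 by rewrite oppr_eq0 !mulf_neq0 ?expf_neq0 ?subr_eq0.
have [a0 a1 a2] : [/\ D 0 0 = l * al ^+ 2, D 0 1 = l * (al * be) & D 0 2%:R = l
  * be ^+ 2].
  by have := D0 0; have := D0 1; have := D0 2%:R; rewrite !mxE.
have [b0 b1 b2] : [/\ D 1 0 = l' * al' ^+ 2, D 1 1 = l' * (al' * be') & D 1
  2%:R = l' * be' ^+ 2].
  by have := D1 0; have := D1 1; have := D1 2%:R; rewrite !mxE.
pose c0 := D 2%:R 0; pose c1 := D 2%:R 1; pose c2 := D 2%:R 2%:R.
pose u := 2%:R * l * (al * be) * c1 - l * al ^+ 2 * c2 - l * be ^+ 2 * c0.
pose v := 2%:R * l' * (al' * be') * c1 - l' * al' ^+ 2 * c2 - l' * be' ^+ 2 * c0.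
pose w := c1 ^+ 2 - c0 * c2.
exists t, (u / t), (v / t), (w / t); split=> //.
have coord i : section 'X_i D = D 0 i *: 'X_0 + D 1 i *: 'X_1 + D 2%:R i *: 'X_2%:R.
  rewrite sectionX !big_ord_recl big_ord0 addr0 addrA.
  have [-> ->] : lift ord0 ord0 = 1 :> 'I_3 /\ lift ord0 (lift ord0 ord0) =
    2%:R :> 'I_3.
    by split; apply: val_inj.
  by [].
have -> : section disc_form D = section 'X_1 D ^+ 2 - section 'X_0 D * section
  'X_2%:R D.
  by rewrite /disc_form /section rmorphB rmorphXn rmorphM.
rewrite /conic_form !scalerDr !scalerA ![t * (_ / t)]mulrC !divfK // !coord.
rewrite a0 a1 a2 b0 b1 b2 -/c0 -/c1 -/c2.
rewrite -!mul_mpolyC.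
have key (R : comNzRingType) (phi : {rmorphism K -> R}) (x0 x1 x2 : R) :
  (phi (l * (al * be)) * x0 + phi (l' * (al' * be')) * x1 + phi c1 * x2) ^+ 2
  - (phi (l * al ^+ 2) * x0 + phi (l' * al' ^+ 2) * x1 + phi c0 * x2)
  * (phi (l * be ^+ 2) * x0 + phi (l' * be' ^+ 2) * x1 + phi c2 * x2)
  = phi t * (x0 * x1) + phi u * (x0 * x2) + phi v * (x1 * x2) + phi w * (x2 * x2).
  by rewrite /t /u /v /w; ring.
exact: (key _ (@mpolyC 3 K)).
Qed.

Lemma section_singular m (f : {mpoly K[m]}) (D : 'M_m) (y : 'rV_m) :
  D \in unitmx -> (forall j, (section f D)^`M(j).@[y 0] = 0) ->
  forall i, f^`M(i).@[(y *m D) 0] = 0.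
Proof.
move=> D_unit dy i; pose g := \col_i f^`M(i).@[(y *m D) 0].
suff /matrixP/(_ i 0) : g = 0 by rewrite !mxE.
rewrite -[g](mulKmx D_unit) [D *m g](_ : _ = 0) ?mulmx0 //.
apply/matrixP => j l; rewrite !mxE -[RHS](dy j) mderiv_section raddf_sum /=.
by apply: eq_bigr => s _; rewrite mevalZ section_meval mxE.
Qed.

End Disc.

Lemma model_sums_neq0 (K : fieldType) (F : {mpoly K[5]}) M c (a : 'rV_5) (B :
  'M_(4, 5)) :
  (forall p : {poly K}, p != 0 -> exists x, p.[x] != 0) -> 2%:R != 0 :> K ->
  igusa_model F M c -> a != 0 -> F.@[a 0] = 0 ->
  row_free B -> (B == tangent F a)%MS -> normal_surface (section F B) ->
  forall i j l, uniq [:: i; j; l] -> (a *m M) 0 i + (a *m M) 0 j + (a *m M) 0 l != 0.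
Proof.
move=> K_inf two_neq0 FM a_neq0 Fa B_free BT f_normal i j l /injection3[f f_inj
  [<- <- <-]].
have := normal_sum3_neq0 (model_reindex FM f_inj) K_inf two_neq0 a_neq0 Fa
  B_free BT f_normal.
by rewrite mulmx_colsub !mxE.
Qed.

(** * The five nodes on the conic *)

Section Nodes.
Variables (K : fieldType) (p q : K).
Hypothesis pq_neq0 : p * q * (p - 1) * (q - 1) * (p * q - 1) != 0.

(** The zeros of the linear factors of [node_form], in the order of the factors. *)
Definition node (i : 'I_5) : K * K :=
  nth (0, 0) [:: (0, 1); (1, 0); (q - 1, 1 - p); (1, p); (q, 1)] i.

Lemma node_form_node i : node_form p q (node i).1 (node i).2 = 0.
Proof.
by case: i => [[|[|[|[|[|//]]]]] lti]; rewrite /node_form /node /=; ring.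
Qed.

(** Up to sign, each of the ten determinants is one of 1, [p], [q], [p - 1], [q - 1],
    [p * q - 1]. *)
Lemma node_cross i j : i != j -> (node i).1 * (node j).2 != (node j).1 * (node i).2.
Proof.
wlog ltij : i j / (i < j)%N => [IH|].
  rewrite neq_ltn => /orP[ltij|ltji]; first by apply: IH; rewrite ?neq_ltn ?ltij.
  by rewrite eq_sym IH // neq_ltn ltji.
move=> _; move: pq_neq0; rewrite !mulf_eq0 !negb_or.
move=> /andP[/andP[/andP[/andP[p0 q0] p1] q1] pq1].
have diff e x y : e != 0 -> x - y = e -> x != y :> K by rewrite -[x ==
  y]subr_eq0 => e0 ->.
have diffN e x y : e != 0 -> y - x = e -> x != y :> K.
  by move=> e0 yx; rewrite eq_sym; exact: diff yx.
case: i j ltij => [[|[|[|[|[|//]]]]] lti] [[|[|[|[|[|//]]]]] ltj] //= _;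
  rewrite /node /=;
  by first [ apply: (diff 1); [exact: oner_neq0|ring] | apply: (diffN 1);
    [exact: oner_neq0|ring]
    | apply: (diff _ _ _ p0); ring | apply: (diffN _ _ _ p0); ring
    | apply: (diff _ _ _ q0); ring | apply: (diffN _ _ _ q0); ring
    | apply: (diff _ _ _ p1); ring | apply: (diffN _ _ _ p1); ring
    | apply: (diff _ _ _ q1); ring | apply: (diffN _ _ _ q1); ring
    | apply: (diff _ _ _ pq1); ring | apply: (diffN _ _ _ pq1); ring].
Qed.

End Nodes.

(** * The conclusion for given parameters, with descent to the base field *)

Section Conclusion.
Variables (k K : fieldType) (iota : {rmorphism k -> K}).
Variables (F : {mpoly k[5]}) (a b : 'rV[k]_5).
Local Notation FK := (map_mpoly iota F).
Local Notation aK := (map_mx iota a).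
Local Notation bK := (map_mx iota b).
Hypotheses (two_neq0 : 2%:R != 0 :> K) (three_neq0 : 3%:R != 0 :> K).
Variables (M : 'M[K]_(5, 6)) (c : K).
Hypothesis FM : igusa_model FK M c.
Variables p q : K.
Hypothesis pq_neq0 : p * q * (p - 1) * (q - 1) * (p * q - 1) != 0.
Variables Ba Bb : 'M[K]_(4, 5).
Hypotheses (Ba_free : row_free Ba) (BaT : (Ba == tangent FK aK)%MS).
Hypotheses (Bb_free : row_free Bb) (BbT : (Bb == tangent FK bK)%MS).

(** At a zero of [node_form] the whole gradient of the quartic vanishes, so [s] is singular on every
    hyperplane section through it. This is why [a] and [b] share these nodes. *)
Lemma singular_on_trope (s : 'rV_5) (x : 'rV_5) (B : 'M_(4, 5)) al be :
  row_free B -> (B == tangent FK x)%MS -> (s <= tangent FK x)%MS -> s != 0 ->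
  s *m M = veronese al be *m trope_mx p q -> node_form p q al be = 0 ->
  singular_on FK (tangent FK x) s.
Proof.
move=> B_free BT sT s_neq0 sE node0.
have /submxP[y yE] : (s <= B)%MS by rewrite (eqmxP BT).
have FKs d : polar FK s d = 0.
  apply/eqP; rewrite (model_polar_eq0 two_neq0 three_neq0 FM); apply/eqP.
  apply: big1 => i _; rewrite (gauss_veronese (p := p) (q := q) (al := al) (be
    := be) (l := 1)).
    by rewrite node0 mulr0 !mul0r.
  by move=> j; rewrite sE scale1r.
exists B, y; split=> //; split.
- by apply: contraNneq s_neq0 => y0; rewrite yE y0 mul0mx.
- rewrite section_meval -yE (model_eval FM) sE /psum.
  under eq_bigr => i _ do rewrite mul_trope_mx.
  under [X in _ * (_ - _ * X)]eq_bigr => i _ do rewrite mul_trope_mx.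
  by rewrite igusa_trope_coord !mxE /=; ring.
- move=> j; rewrite mderiv_section raddf_sum big1 //= => i _.
  rewrite mevalZ section_meval -yE.
  have := FKs (delta_mx 0 i); rewrite /polar (bigD1 i) //= mxE !eqxx mulr1.
  rewrite big1 ?addr0 => [->|l li]; first by rewrite mulr0.
  by rewrite mxE (negPf li) andbF mulr0.
Qed.

Hypotheses (a_neq0 : a != 0) (b_neq0 : b != 0).
Hypotheses (Fa : F.@[a 0] = 0) (Fb : F.@[b 0] = 0) (ab : ~~ (a == b)%MS).
Hypotheses (Pab : polar F a b = 0) (Pba : polar F b a = 0).
Hypotheses (pa : trope_param p q ((aK *m M) 0)) (pb : trope_param p q ((bK *m M) 0)).

Lemma proposition4p7_param :
  [/\ trope F (tangent F a) (tangent F a :&: tangent F b)%MS,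
      trope F (tangent F b) (tangent F a :&: tangent F b)%MS &
      exists (B : 'M[k]_(3, 5)) (q : {mpoly k[3]}),
        [/\ cuts_double_conic F (tangent F a :&: tangent F b)%MS B q,
            on_conic B q a,
            on_conic B q b &
            exists s : 'I_5 -> 'rV[K]_5,
              (forall i j, i != j -> ~~ (s i == s j)%MS) /\
              (forall i,
                 [/\ singular_on FK (tangent FK aK) (s i),
                     singular_on FK (tangent FK bK) (s i) &
                     on_conic (map_mx iota B) (map_mpoly iota q) (s i)])]].
Proof.
have [M_free _ c_neq0 FKE] := FM.
have M_inj := row_free_inj M_free.
have [al [be [l [l_neq0 aE]]]] := trope_param_veronese pa.
have [al' [be' [l' [l'_neq0 bE]]]] := trope_param_veronese pb.
have bK_neq0 : bK != 0 by rewrite map_mx_eq0.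
have aK_neq0 : aK != 0 by rewrite map_mx_eq0.
have bNa : ~~ (b <= a)%MS.
  apply: contra ab => ba; rewrite andbC ba /= -(geq_leqif (mxrank_leqif_sup ba)).
  by rewrite !rank_rV a_neq0 b_neq0.
have cross : al * be' != al' * be.
  apply: contra bNa => /eqP/esym E; rewrite -(map_submx iota).
  have [|t tE] := veronese_proportional (al := al') (be := be') (al' := al)
    (be' := be) _ E.
    apply: contraNneq aK_neq0 => v0.
    by apply/eqP; apply: M_inj; rewrite /= mul0mx aE v0 mul0mx scaler0.
  apply/sub_rVP; exists (l' * t / l); apply: M_inj.
  by rewrite /= bE tE -[RHS]scalemxAl aE scalerA divfK // -scalemxAl scalerA.
have rTa : \rank (tangent FK aK) = 4%N by rewrite -(eqmxP BaT) (eqP Ba_free).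
have [T [TM PT]] := common_tangent_rank two_neq0 three_neq0 FM pq_neq0 rTa aE bE
  (tangent_hyperplane Ba_free BaT) (tangent_hyperplane Bb_free BbT) cross.
have T_free : row_free T.
  rewrite -kermx_eq0; apply/eqP/(trope_mx_inj two_neq0 three_neq0 pq_neq0).
  by rewrite -TM mulmxA mulmx_ker mul0mx.
have T_inj := row_free_inj T_free.
set P := (tangent F a :&: tangent F b)%MS.
have PK : (map_mx iota P == T)%MS.
  apply/eqmxP/(eqmx_trans (map_capmx _ _ _)); rewrite -!map_tangent; exact/eqmxP.
have rP : \rank P = 3%N by rewrite -(mxrank_map iota) (eqmxP PK) (eqP T_free).
have polar_self (x : 'rV_5) : F.@[x 0] = 0 -> polar F x x = 0.
  move=> Fx; apply: (fmorph_inj iota); rewrite -map_polar rmorph0.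
  by apply: (model_polar_self FM); rewrite map_meval Fx rmorph0.
have aP : (a <= P)%MS.
  rewrite sub_capmx; apply/andP.
  by split; apply/sub_tangent => i; rewrite ord1 row_id ?polar_self.
have bP : (b <= P)%MS.
  rewrite sub_capmx; apply/andP.
  by split; apply/sub_tangent => i; rewrite ord1 row_id ?polar_self.
have U_free : row_free (col_mx a b) by apply: row_free_colr;
  rewrite // /row_free rank_rV a_neq0.
have [|w wP B_free] := exists_row_free_colr (P := P) U_free; first by rewrite rP.
(* With [a] and [b] as first basis vectors, the conic takes the shape [conic_form] and descends to
   [k]. *)
pose B : 'M_(3, 5) := col_mx (col_mx a b) w.
have BP : (B == P)%MS.
  have BP0 : (col_mx (col_mx a b) w <= P)%MS by rewrite !col_mx_sub aP bP wP.
  have BP : (B <= P)%MS := BP0.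
  by rewrite BP -(geq_leqif (mxrank_leqif_sup BP)) rP (eqP B_free).
have B0 : row 0 B = a.
  have -> : 0 = lshift 1 (lshift 1 (0 : 'I_1)) :> 'I_(1 + 1 + 1) by exact: val_inj.
  by apply/rowP => j; rewrite [LHS]mxE; apply: etrans (col_mxEu _ _ _ _) _;
    rewrite col_mxEu.
have B1 : row 1 B = b.
  have -> : 1 = lshift 1 (rshift 1 (0 : 'I_1)) :> 'I_(1 + 1 + 1) by exact: val_inj.
  by apply/rowP => j; rewrite [LHS]mxE; apply: etrans (col_mxEu _ _ _ _) _;
    rewrite col_mxEd.
(* Over [K], [D] relates the basis [B] defined over [k] to the basis [T], in which the conic is
   [disc_form]. *)
have /submxP[D DE] : (map_mx iota B <= T)%MS.
  by rewrite -(eqmxP PK) map_submx (eqmxP BP).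
have D_unit : D \in unitmx.
  rewrite -row_free_unit -row_leq_rank; apply: leq_trans (mxrankM_maxl D T).
  by rewrite -DE mxrank_map (eqP B_free).
have rowD i al0 be0 l0 x : row i B = x ->
    map_mx iota x *m M = l0 *: (veronese al0 be0 *m trope_mx p q) ->
    row i D = l0 *: veronese al0 be0.
  move=> Bi xE; apply: T_inj; apply: M_inj.
  by rewrite /= -row_mul -DE -map_row Bi xE -TM mulmxA -!scalemxAl.
have [t [u [v [z [t_neq0 discE]]]]] := section_disc_form (rowD _ _ _ _ _ B0 aE)
  (rowD _ _ _ _ _ B1 bE) l_neq0 l'_neq0 cross.
pose kap := - (18%:R * (p * q * (p - 1) * (q - 1) * (p * q - 1))) ^+ 2.
have kap_neq0 : kap != 0.
  rewrite oppr_eq0 expf_neq0 // mulf_neq0 // (natrM _ 2 9) (natrM _ 3 3).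
  by rewrite !mulf_neq0.
have fE : map_mpoly iota (section F B) = (c * kap * t ^+ 2) *: conic_form u v z ^+ 2.
  rewrite map_section FKE sectionZ section_section DE -mulmxA TM.
  rewrite -section_section section_trope_mx -/kap sectionZ -/disc_form.
  have -> : section (disc_form K ^+ 2) D = (section (disc_form K) D) ^+ 2.
    by rewrite /section rmorphXn.
  by rewrite discE exprZn !scalerA.
have two_neq0k : 2%:R != 0 :> k by rewrite -(fmorph_eq0 iota) rmorph_nat.
have C_neq0 : c * kap * t ^+ 2 != 0 by rewrite !mulf_neq0 ?expf_neq0.
have [C0 [u0 [v0 [z0 [C0E u0E v0E z0E fkE]]]]] := square_descent two_neq0k C_neq0 fE.
pose Q := conic_form u0 v0 z0.
have QK : section (disc_form K) D = t *: map_mpoly iota Q.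
  by rewrite /Q map_conic_form u0E v0E z0E.
have cuts : cuts_double_conic F P B Q.
  split=> //; last first.
    by exists C0 => //; rewrite -(fmorph_eq0 iota) C0E.
  split; first exact: conic_form_homog.
  move=> y [y_neq0 _ dy]; move/eqP: y_neq0; apply.
  apply/eqP; rewrite -(map_mx_eq0 iota); apply/eqP.
  suff : map_mx iota y *m D = 0 by move/(canRL (mulmxK D_unit)); rewrite mul0mx.
  apply: (disc_form_smooth two_neq0); apply: section_singular D_unit _ => j.
  by rewrite QK mderivZ mevalZ -map_mderiv map_meval dy rmorph0 mulr0.
have trP : (P <= tangent F a)%MS /\ (P <= tangent F b)%MS by rewrite capmxSl capmxSr.
have [PTa PTb] := trP.
split; [by split=> //; exists B, Q|by split=> //; exists B, Q|].
exists B, Q; split=> //.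
- exists (delta_mx 0 0); first by rewrite -rowE B0.
  by rewrite conic_form_eval !mxE /=; ring.
- exists (delta_mx 0 1); first by rewrite -rowE B1.
  by rewrite conic_form_eval !mxE /=; ring.
pose nv i : 'rV[K]_3 := veronese (node p q i).1 (node p q i).2.
have nv_neq0 i : nv i != 0.
  have [j ij] : exists j, i != j.
    by case: (eqVneq i 0) => [->|i0]; [exists 1|exists 0].
  apply: contraNneq (node_cross pq_neq0 ij) => nv0; apply/eqP.
  by apply: (veronese_cross (t := 0)); rewrite scale0r; exact: nv0.
have sT i : (nv i *m T <= tangent FK aK :&: tangent FK bK)%MS.
  by rewrite (eqmxP PT) submxMl.
have s_neq0 i : nv i *m T != 0.
  by apply: contraNneq (nv_neq0 i) => nT0; apply/eqP; apply: T_inj;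
    rewrite /= nT0 mul0mx.
have sM i : nv i *m T *m M = nv i *m trope_mx p q by rewrite -mulmxA TM.
exists (fun i => nv i *m T); split=> [i j ij|i].
  apply: contra (node_cross pq_neq0 ij) => /andP[/sub_rVP[r E] _].
  by apply/eqP/(veronese_cross (t := r)); apply: T_inj; rewrite /= -scalemxAl.
have := sT i; rewrite sub_capmx => /andP[sTa sTb]; split.
- exact: singular_on_trope Ba_free BaT sTa (s_neq0 i) (sM i) (node_form_node _ _ i).
- exact: singular_on_trope Bb_free BbT sTb (s_neq0 i) (sM i) (node_form_node _ _ i).
exists (nv i *m invmx D); first by rewrite DE -!mulmxA mulKmx.
apply: (mulfI t_neq0); rewrite -mevalZ -QK section_meval mulmxKV //.
by rewrite disc_form_veronese mulr0.
Qed.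

End Conclusion.

Theorem proposition4p7 (k K : fieldType) (iota : {rmorphism k -> K})
    (F : {mpoly k[5]}) (a b : 'rV[k]_5)
    (hk : 2%N \notin [pchar k])
    (hK : separable_closure iota)
    (hF : igusa_quartic iota F)
    (ha0 : a != 0) (hb0 : b != 0)
    (ha : F.@[a 0] = 0) (hb : F.@[b 0] = 0)
    (haE : ~ in_E (map_mpoly iota F) (map_mx iota a))
    (hbE : ~ in_E (map_mpoly iota F) (map_mx iota b))
    (hab : ~~ (a == b)%MS)
    (hPab : polar F a b = 0) (hPba : polar F b a = 0) :
  [/\ trope F (tangent F a) (tangent F a :&: tangent F b)%MS,
      trope F (tangent F b) (tangent F a :&: tangent F b)%MS &
      exists (B : 'M[k]_(3, 5)) (q : {mpoly k[3]}),
        [/\ cuts_double_conic F (tangent F a :&: tangent F b)%MS B q,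
            on_conic B q a,
            on_conic B q b &
            exists s : 'I_5 -> 'rV[K]_5,
              (forall i j, i != j -> ~~ (s i == s j)%MS) /\
              (forall i,
                 [/\ singular_on (map_mpoly iota F)
                       (tangent (map_mpoly iota F) (map_mx iota a)) (s i),
                     singular_on (map_mpoly iota F)
                       (tangent (map_mpoly iota F) (map_mx iota b)) (s i) &
                     on_conic (map_mx iota B) (map_mpoly iota q) (s i)])]].
Proof.
have two_neq0 : 2%:R != 0 :> K.
  by rewrite -(rmorph_nat iota) fmorph_eq0; apply: contra hk => two0; rewrite inE.
have K_inf := sqrt_closed_infinite two_neq0 (separably_closed_sqrt two_neq0 hK.2).
have [_ [M [c [M_free M0 c_neq0 FE]]]] := hF.
have FM : igusa_model (map_mpoly iota F) M c by [].
set FK := map_mpoly iota F in FE FM haE hbE *.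
set aK := map_mx iota a in haE *; set bK := map_mx iota b in hbE *.
have Fa : FK.@[aK 0] = 0 by rewrite map_meval ha rmorph0.
have Fb : FK.@[bK 0] = 0 by rewrite map_meval hb rmorph0.
have a_neq0 : aK != 0 by rewrite map_mx_eq0.
have b_neq0 : bK != 0 by rewrite map_mx_eq0.
have [Ba [Ba_free BaT Ba_normal]] := not_in_E_normal Fa haE.
have [Bb [Bb_free BbT Bb_normal]] := not_in_E_normal Fb hbE.
have three_neq0 := normal_char_neq3 FM K_inf a_neq0 Fa Ba_free BaT Ba_normal.
have gauss_polar x y : polar F x y = 0 ->
    \sum_i gauss ((map_mx iota x *m M) 0) i * (map_mx iota y *m M) 0 i = 0.
  move=> xy; apply/eqP; rewrite -(model_polar_eq0 two_neq0 three_neq0 FM).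
  by rewrite map_polar xy rmorph0.
have [f [p [q [f_inj pq_neq0 pa pb]]]] := common_trope two_neq0 three_neq0
  (model_on_igusa FM Fa) (model_on_igusa FM Fb)
  (model_sums_neq0 K_inf two_neq0 FM a_neq0 Fa Ba_free BaT Ba_normal)
  (model_sums_neq0 K_inf two_neq0 FM b_neq0 Fb Bb_free BbT Bb_normal)
  (gauss_polar _ _ hPab) (gauss_polar _ _ hPba).
(* The permutation [f] is absorbed into the columns of [M]; the points [a] and [b] do not change. *)
have param (x : 'rV_5) : trope_param p q ((x *m M) 0 \o f) ->
    trope_param p q ((x *m colsub f M) 0).
  move=> [al [be [l [l_neq0 E]]]]; exists al, be, l; split=> // i.
  by rewrite -E /= mulmx_colsub mxE.
exact: (proposition4p7_param two_neq0 three_neq0 (model_reindex FM f_inj) pq_neq0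
  Ba_free BaT Bb_free BbT ha0 hb0 ha hb hab hPab hPba (param _ pa) (param _ pb)).
Qed.
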